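(* Let $K$ be an algebraically closed field of characteristic $0$. For a finite set $A=\{a_1,\dots,a_n\}\subset K$ of $n$ distinct elements, let $$A^+=\Big\{\sum_{i=1}^n\epsilon_ia_i:\ \epsilon_i\in\{0,1\}\Big\},\qquad A^\times=\Big\{\prod_{i=1}^n a_i^{\epsilon_i}:\ \epsilon_i\in\{0,1\}\Big\},$$ and for a positive integer $N$ let $g_K(N)=\min\{|A^+|+|A^\times| : A\subset K,\ |A|=N\}$. Then for every $\epsilon>0$ and every sufficiently large $N$ (depending on $\epsilon$), $$g_K(N)\geq N^{\left(\frac{1}{264}-\epsilon\right)\frac{\log\log N}{\log\log\log N}}.$$
   Context: $A^+$ is the set of sums of distinct elements of $A$ (including the empty sum) and $A^\times$ the set of products of distinct elements of $A$ (including the empty product). *)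

(* Defs.v *)
From HB Require Import structures.
From mathcomp Require Import all_boot all_order all_algebra.
From mathcomp Require Import finmap.
Set Implicit Arguments. Unset Strict Implicit. Unset Printing Implicit Defensive.
Import GRing.Theory.
Local Open Scope fset_scope.
Local Open Scope ring_scope.

Definition sumset (K : fieldType) (A : {fset K}) : {fset K} :=
  [fset (\sum_(x <- B) x) | B : {fset K} in fpowerset A].

Definition prodset (K : fieldType) (A : {fset K}) : {fset K} :=
  [fset (\prod_(x <- B) x) | B : {fset K} in fpowerset A].

(* Main.v *)
(* Let N = |A| and suppose that both sets of subset sums and products of A have
   at most 2^t elements.  Multiplying (resp. adding) many disjoint blocks of A one
   after the other, some block P barely enlarges the accumulated set B in both
   operations.  Then B is almost invariant under the quotients (resp. differences)
   of elements of P, so that long words in these lie in B/B (resp. B-B), which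
   bounds by d the multiplicative rank of P/P and the additive rank of P-P.

   A subset of P whose subset sums are distinct has at most t elements.  Hence each
   valuation ring takes at most t classes on P, and each absolute value at most t
   classes up to a factor 2.  Each time some quotient of P is not an algebraic
   integer, a valuation ring detects it, and passing to a largest class lowers the
   multiplicative rank.  After d steps all quotients are units in a number field,
   and the same argument with archimedean places leaves W such that all conjugates
   of the quotients of W are bounded by some R.  As W spans a space of dimension at
   most d, if W had more than 2^(ds) elements two of them would differ by 2^s z
   with z integral; for 2^s > 2R the norm of z would be less than 1.

   With a = log_2 N and b = log_2 a this works for d = b/8 and t = (d+1)a/8, and
   then 2^t >= N^(log log N / 264). *)

Require Import Defs.
From HB Require Import structures.
From mathcomp Require Import all_boot all_order all_fingroup all_algebra all_field.
From mathcomp Require Import boolp classical_sets.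
From mathcomp Require Import finmap zify ring lra.
Set Implicit Arguments.
Unset Strict Implicit.
Unset Printing Implicit Defensive.
Import Order.TTheory GRing.Theory Num.Theory.
Local Open Scope fset_scope.
Local Open Scope nat_scope.

(** * Sets almost invariant under a commutative operation *)

Lemma leq_card_fsetM (T U : choiceType) (A : {fset T}) (B : {fset U}) :
  #|` A `*` B| <= #|` A| * #|` B|.
Proof.
rewrite -(size_allpairs pair); apply: uniq_leq_size (fset_uniq _) _ => -[x y].
by rewrite in_fsetM => /andP[/= Ax By]; apply/allpairsP; exists (x, y).
Qed.

Definition setop (T : choiceType) (op : T -> T -> T) (B P : {fset T}) : {fset T} :=
  [fset op x.1 x.2 | x in B `*` P].

Section AlmostInvariant.

Variables (T : choiceType) (idx : T) (op : Monoid.com_law idx) (inv : T -> T).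
(** [inv] is an inverse only inside [D]. Later [D] consists of the nonzero elements for
    multiplication and of everything for addition. *)
Variable D : {pred T}.
Hypothesis Dop : {in D &, forall x y, op x y \in D}.
Hypothesis Dinv : {in D, forall x, inv x \in D}.
Hypothesis opV : {in D, forall x, op x (inv x) = idx}.

Let mA : associative op. Proof. exact: Monoid.mulmA. Qed.
Let mC : commutative op. Proof. exact: Monoid.mulmC. Qed.
Let m1 : right_id idx op. Proof. exact: Monoid.mulm1. Qed.

Lemma setopP (B P : {fset T}) z :
  reflect (exists b p, [/\ b \in B, p \in P & z = op b p]) (z \in setop op B P).
Proof.
apply: (iffP (imfsetP _ _ _ _)) => [[[b p] /=]|[b [p [Bb Pp ->]]]].
  by rewrite in_fsetM => /andP[Bb Pp] ->; exists b, p.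
by exists (b, p) => //=; rewrite in_fsetM Bb.
Qed.

Lemma opK x y : x \in D -> op (op y x) (inv x) = y.
Proof. by move=> Dx; rewrite -mA opV // m1. Qed.

Lemma op_inj x : x \in D -> injective (fun y => op y x).
Proof. by move=> Dx; apply: (@can_inj _ _ _ (fun z => op z (inv x)) (fun y => opK y Dx)). Qed.

Lemma leq_setop (B P : {fset T}) p : p \in P -> p \in D ->
  #|` B| <= #|` setop op B P|.
Proof.
move=> Pp Dp; have <- : #|` [fset op b p | b in B]| = #|` B| by apply/card_imfset/op_inj.
rewrite fsubset_leq_card //.
by apply/fsubsetP=> _ /imfsetP[b /= Bb ->]; apply/setopP; exists b, p.
Qed.

Section Fix.

Variables B P : {fset T}.
Hypothesis PD : {subset P <= D}.
Hypothesis BD : {subset B <= D}.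

Definition ratio c := exists a a', [/\ a \in P, a' \in P & c = op a (inv a')].

Let s := #|` setop op B P| - #|` B|.

(** Write c = a / a'. The translate by a of the bad elements is disjoint from the translate of [B]
    by a', for otherwise b c would be in [B]. Both translates lie in [setop op B P], which leaves
    room for at most [s] bad elements. *)
Lemma card_ratio_bad c : ratio c -> #|` [fset b in B | op b c \notin B]| <= s.
Proof.
move=> [a [a' [Pa Pa' ->]]]; have [Da Da'] := (PD Pa, PD Pa').
set X := [fset b in B | _].
pose X' := [fset op b a | b in X]; pose Y := [fset op b a' | b in B].
have cX : #|` X'| = #|` X| by apply/card_imfset/op_inj.
have cY : #|` Y| = #|` B| by apply/card_imfset/op_inj.
have dXY : [disjoint X' & Y].
  apply/fdisjointP => _ /imfsetP[b /= Xb ->]; apply/imfsetP => -[b' /= Bb' e].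
  move: Xb; rewrite !inE /= => /andP[_ /negP]; apply.
  by rewrite mA e opK.
have sub : X' `|` Y `<=` setop op B P.
  apply/fsubsetP=> z; rewrite inE => /orP[] /imfsetP[b /= Xb ->]; apply/setopP.
    by exists b, a; split=> //; move: Xb; rewrite !inE => /andP[].
  by exists b, a'.
have := fsubset_leq_card sub.
have /eqP -> : #|` X' `|` Y| == #|` X'| + #|` Y|.
  by rewrite -cardfsUI (eqP dXY) cardfs0 addn0.
by rewrite cX cY /s; lia.
Qed.

(** Union bound over the letters: if b is bad for c w, then either b is already bad for c, or b c
    lies in [B] and is bad for w. Translation by c is injective, so the second kind is counted by
    induction. *)
Lemma card_word_bad (w : seq T) : (forall c, c \in w -> ratio c) ->
  #|` [fset b in B | op b (\big[op/idx]_(c <- w) c) \notin B]| <= size w * s.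
Proof.
elim: w => [|c w IH] rw.
  rewrite big_nil mul0n leqn0 cardfs_eq0; apply/eqP/fsetP=> b.
  by rewrite !inE m1 /=; case: (b \in B).
have rc : ratio c by apply: rw; rewrite inE eqxx.
have Dc : c \in D.
  by case: rc => a [a' [Pa Pa' ->]]; apply: Dop; [apply: PD|apply/Dinv/PD].
have {}IH := IH (fun x xw => rw x (mem_behead (s := c :: w) xw)).
set Z := [fset b in B | _] in IH.
pose Z' := [fset b in B | op b c \in Z].
apply: (@leq_trans #|` [fset b in B | op b c \notin B] `|` Z'|).
  apply/fsubset_leq_card/fsubsetP=> b; rewrite !inE /= big_cons mA.
  by case: (b \in B) => //= ->; rewrite andbT; case: (op b c \in B).
apply: (leq_trans (leq_card_fsetU _ _)).
rewrite /= mulSn leq_add //; first exact: card_ratio_bad.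
apply: leq_trans IH.
have <- : #|` [fset op b c | b in Z']| = #|` Z'| by apply/card_imfset/op_inj.
apply/fsubset_leq_card/fsubsetP=> _ /imfsetP[b /= + ->].
by rewrite !inE /= => /andP[].
Qed.

Lemma word_mem (w : seq T) : (forall c, c \in w -> ratio c) ->
  size w * s < #|` B| ->
  exists b b', [/\ b \in B, b' \in B & op b (\big[op/idx]_(c <- w) c) = b'].
Proof.
move=> rw ltB; have := card_word_bad rw.
set Z := [fset b in B | _] => leZ.
have /fset0Pn[b] : B `\` Z != fset0.
  apply/eqP=> e; have : B `<=` Z by rewrite -fsetD_eq0 e.
  by move/fsubset_leq_card; lia.
rewrite !inE /= => /andP[+ Bb]; rewrite Bb /= negbK => h.
by exists b, (op b (\big[op/idx]_(c <- w) c)).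
Qed.

(** The E^k monomials in the [g i] with exponents below [E] are distinct by independence. Each is a
    word of length at most k E, hence sends some element of [B] into [B], so it is a quotient of two
    elements of [B]. *)
Lemma independent_ratios_bound k E (g : nat -> T) :
    (forall i, i < k -> ratio (g i)) ->
    (forall e f : nat -> nat,
      \big[op/idx]_(i < k) iter (e i) (op (g i)) idx
        = \big[op/idx]_(i < k) iter (f i) (op (g i)) idx ->
      forall i, i < k -> e i = f i) ->
    k * E * s < #|` B| ->
  E ^ k <= #|` B| ^ 2.
Proof.
move=> rg indep ltB.
have [->|E0] := posnP E.
  have B0 : 0 < #|` B| by lia.
  by case: k {rg indep ltB} => [|k]; [rewrite expn0 expn_gt0 B0|rewrite exp0n].
(* Independence speaks of exponents indexed by [nat], so the vector is extended by 0 beyond [k]. *)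
pose v (e : {ffun 'I_k -> 'I_E}) i := if insub i is Some j then e j : nat else 0.
pose pr (e : {ffun 'I_k -> 'I_E}) :=
  \big[op/idx]_(i < k) iter (v e i) (op (g i)) idx.
have pr_inj : injective pr.
  move=> e f /indep ef; apply/ffunP=> i; apply: val_inj.
  have := ef _ (ltn_ord i); rewrite /v.
  by rewrite (insubT (fun j => j < k) (ltn_ord i)) /= (_ : Sub _ _ = i) //; apply: val_inj.
have prB e : exists b b', [/\ b \in B, b' \in B & op b (pr e) = b'].
  pose w := flatten [seq nseq (v e i) (g i) | i <- iota 0 k].
  have wE : \big[op/idx]_(c <- w) c = pr e.
    rewrite /w /pr big_flatten /= big_map -/(index_iota 0 k).
    rewrite -[in LHS](subn0 k) -/(index_iota 0 k) big_mkord.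
    by apply: eq_bigr => i _; rewrite big_nseq.
  rewrite -wE; apply: word_mem.
    move=> c /flattenP[_ /mapP[i + ->]]; rewrite mem_iota /= => ik.
    by rewrite mem_nseq => /andP[_ /eqP->]; apply: rg.
  apply: leq_ltn_trans ltB; rewrite leq_mul2r; apply/orP; right.
  rewrite size_flatten /shape -map_comp sumnE big_map.
  rewrite (eq_bigr (fun i => v e i)); last by move=> i _; rewrite /= size_nseq.
  apply: (@leq_trans (\sum_(i <- iota 0 k) E)).
    apply: leq_sum => i _; rewrite /v; case: insubP => // j _ _; exact: ltnW.
  by rewrite big_const_seq count_predT size_iota iter_addn_0 mulnC.
pose Q := [fset op x.1 (inv x.2) | x in B `*` B].
have prQ e : pr e \in Q.
  have [b [b' [Bb Bb' e1]]] := prB e.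
  apply/imfsetP; exists (b', b) => /=; first by rewrite in_fsetM Bb' Bb.
  by rewrite -e1 (mC b) opK ?BD.
have -> : E ^ k = #|` [fset pr e | e in {ffun 'I_k -> 'I_E}]|.
  by rewrite card_imfset //= -cardE card_ffun !card_ord.
apply: leq_trans (fsubset_leq_card (_ : _ `<=` Q)) _.
  by apply/fsubsetP=> _ /imfsetP[e _ ->].
apply: leq_trans (leq_imfset_card _ _ _) _.
by rewrite -mulnn; exact: leq_card_fsetM.
Qed.

End Fix.
End AlmostInvariant.

(** * A block that barely enlarges a set under both operations *)

Lemma subset_of_card (T : choiceType) (A : {fset T}) q : q <= #|` A| ->
  exists2 P : {fset T}, P `<=` A & #|` P| = q.
Proof.
move=> qA; exists [fset x in take q (enum_fset A)].
  by apply/fsubsetP=> x; rewrite !inE /= => /mem_take.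
rewrite card_fseq undup_id ?size_take; last exact/take_uniq/fset_uniq.
by case: ltnP => // h; apply/eqP; rewrite eqn_leq qA h.
Qed.

(** This is (1 + 1/l)^l >= 2; [H] is Bernoulli's inequality (1 + 1/l)^m >= 1 + m/l cleared of
    denominators. *)
Lemma double_expn l : 0 < l -> 2 * l ^ l <= l.+1 ^ l.
Proof.
move=> l0.
have H m : (l + m) * l ^ m <= l.+1 ^ m * l.
  by elim: m => [|m IH]; rewrite ?expn0 ?muln1 ?addn0 ?mul1n // !expnS; nia.
by have := H l; rewrite addnn -mul2n mulnAC leq_pmul2r.
Qed.

Section GoodBlock.

Variables (T : choiceType) (i1 i2 : T) (op1 : Monoid.com_law i1) (op2 : Monoid.com_law i2).

(** Common form of [sumset] and [prodset], which are its instances for addition and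
    multiplication. *)
Definition opset (idx : T) (op : T -> T -> T) (A : {fset T}) : {fset T} :=
  [fset \big[op/idx]_(x <- B) x | B : {fset T} in fpowerset A].

Lemma opsetP (idx : T) (op : T -> T -> T) A z :
  reflect (exists2 B : {fset T}, B `<=` A & z = \big[op/idx]_(x <- B) x)
          (z \in opset idx op A).
Proof.
apply: (iffP (imfsetP _ _ _ _)) => -[B /= BA ->]; exists B => //; move: BA;
by rewrite fpowersetE.
Qed.

(** Preserves the invariant of [good_block] when the block [P] is used up: an element p of [P] is
    not in C, so it can be absorbed into C as one more distinct factor from [A']. *)
Lemma setop_extend (idx : T) (op : Monoid.com_law idx) (A A' P B : {fset T}) :
    P `<=` A' ->
    (forall b C, b \in B -> C `<=` A' ->
      op b (\big[op/idx]_(x <- C) x) \in opset idx op A) ->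
  forall b C, b \in setop op B P -> C `<=` A' `\` P ->
    op b (\big[op/idx]_(x <- C) x) \in opset idx op A.
Proof.
move=> PA' H _ C /setopP[b [p [Bb Pp ->]]] CA.
have pC : p \notin C.
  by apply/negP=> /(fsubsetP CA); rewrite inE Pp.
have mA : associative op by exact: Monoid.mulmA.
rewrite -mA -(big_fsetU1 op id pC) //; apply: H => //.
by rewrite fsubUset fsub1set (fsubsetP PA') //= (fsubset_trans CA) ?fsubsetDl.
Qed.

(* If every block fails, [#|B1| * #|B2|] grows by a factor [1 + 1/l] at each of the
   [l * (2t+1)] steps, hence by more than [2^(2t)] in total. *)
Lemma good_block (D1 D2 : {pred T}) (inv1 inv2 : T -> T) (A : {fset T}) t l q :
    {in D1 &, forall x y, op1 x y \in D1} ->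
    {in D2 &, forall x y, op2 x y \in D2} ->
    {in D1, forall x, op1 x (inv1 x) = i1} ->
    {in D2, forall x, op2 x (inv2 x) = i2} ->
    i1 \in D1 -> i2 \in D2 ->
    {subset A <= D1} -> {subset A <= D2} ->
    0 < q -> 0 < l -> l * t.*2.+1 * q <= #|` A| ->
    #|` opset i1 op1 A| <= 2 ^ t -> #|` opset i2 op2 A| <= 2 ^ t ->
  exists P B1 B2, [/\ P `<=` A, #|` P| = q,
    [/\ {subset B1 <= D1}, #|` B1| <= 2 ^ t
      & l * (#|` setop op1 B1 P| - #|` B1|) < #|` B1|]
  & [/\ {subset B2 <= D2}, #|` B2| <= 2 ^ t
      & l * (#|` setop op2 B2 P| - #|` B2|) < #|` B2|]].
Proof.
move=> Dop1 Dop2 opV1 opV2 D1i D2i AD1 AD2 q0 l0 leA le1 le2.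
set goal := ex _.
(* [A'] is the part of [A] not yet used. Any element of [B] times distinct elements of [A'] stays in
   the product set of [A]; with no further factor this bounds the size of [B]. *)
pose inv (idx : T) (op : Monoid.com_law idx) (D : {pred T}) (A' B : {fset T}) :=
  [/\ {subset B <= D}, 0 < #|` B| &
   forall b C, b \in B -> C `<=` A' ->
      op b (\big[op/idx]_(x <- C) x) \in opset idx op A].
have invB (idx : T) (op : Monoid.com_law idx) D A' B : inv idx op D A' B ->
    #|` B| <= #|` opset idx op A|.
  move=> [_ _ H]; apply/fsubset_leq_card/fsubsetP=> b Bb.
  by have := H b fset0 Bb (fsub0set _); rewrite big_seq_fset0 Monoid.mulm1.
have step j : j <= l * t.*2.+1 -> goal \/ exists A' B1 B2,
   [/\ A' `<=` A, #|` A| <= #|` A'| + j * q, inv i1 op1 D1 A' B1, inv i2 op2 D2 A' B2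
     & l.+1 ^ j <= #|` B1| * #|` B2| * l ^ j].
  elim: j => [_|j IH jn].
    right; exists A, [fset i1], [fset i2]; split=> //.
    - by rewrite addn0.
    - split=> [x||b C]; [by rewrite inE => /eqP->|by rewrite cardfs1|].
      rewrite in_fset1 => /eqP-> CA; rewrite Monoid.mul1m; apply/opsetP; by exists C.
    - split=> [x||b C]; [by rewrite inE => /eqP->|by rewrite cardfs1|].
      rewrite in_fset1 => /eqP-> CA; rewrite Monoid.mul1m; apply/opsetP; by exists C.
    - by rewrite !cardfs1.
  have [|G|] := IH; [exact: ltnW|by left|].
  move=> [A' [B1 [B2 [A'A leA' I1 I2 leB]]]].
  have qA' : q <= #|` A'| by nia.
  have [P PA' cP] := subset_of_card qA'.
  have PA := fsubset_trans PA' A'A.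
  have /fset0Pn[p Pp] : P != fset0 by rewrite -cardfs_gt0 cP.
  have pA := fsubsetP PA _ Pp.
  have [S1 S2] : #|` B1| <= #|` setop op1 B1 P| /\ #|` B2| <= #|` setop op2 B2 P|.
    split; [exact: (leq_setop opV1 _ Pp (AD1 _ pA))|exact: (leq_setop opV2 _ Pp (AD2 _ pA))].
  have [I1D I1p I1o] := I1; have [I2D I2p I2o] := I2.
  have [/andP[G1 G2]|G] := boolP
    ((l * (#|` setop op1 B1 P| - #|` B1|) < #|` B1|)
      && (l * (#|` setop op2 B2 P| - #|` B2|) < #|` B2|)).
    left; exists P, B1, B2; split=> //; split=> //.
    - exact: leq_trans (invB _ _ _ _ _ I1) le1.
    - exact: leq_trans (invB _ _ _ _ _ I2) le2.
  right; exists (A' `\` P), (setop op1 B1 P), (setop op2 B2 P); split.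
  - by rewrite (fsubset_trans _ A'A) ?fsubsetDl.
  - by rewrite cardfsDS // cP mulSn; lia.
  - split; [|exact: leq_trans S1|exact: setop_extend].
    by move=> z /setopP[b [y [Bb Py ->]]]; apply: Dop1; [apply: I1D|apply/AD1/(fsubsetP PA)].
  - split; [|exact: leq_trans S2|exact: setop_extend].
    by move=> z /setopP[b [y [Bb Py ->]]]; apply: Dop2; [apply: I2D|apply/AD2/(fsubsetP PA)].
  rewrite !expnS; move: leB S1 S2 G; rewrite negb_and -!leqNgt.
  move: (l ^ j) (l.+1 ^ j) => x y.
  move: #|` B1| #|` B2| #|` setop _ _ _| #|` setop _ _ _| => b1 b2 c2 c1 leB S1 S2.
  move=> /orP[] G; apply: leq_trans (leq_mul (leqnn l.+1) leB) _.
    have /(leq_mul S2) : l.+1 * b1 <= l * c1.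
      move: G (leq_mul (leqnn l) S1); rewrite mulnBr mulSn. lia.
    by move/(leq_mul (leqnn x)); nia.
  have /(leq_mul S1) : l.+1 * b2 <= l * c2.
      by move: G (leq_mul (leqnn l) S2); rewrite mulnBr mulSn; lia.
  by move/(leq_mul (leqnn x)); nia.
have [//|[A' [B1 [B2 [_ _ I1 I2 leB]]]]] := step _ (leqnn _).
have h1 := leq_trans (invB _ _ _ _ _ I1) le1.
have h2 := leq_trans (invB _ _ _ _ _ I2) le2.
have := leq_mul (leq_mul h1 h2) (leqnn (l ^ (l * t.*2.+1))).
rewrite -expnD addnn => /(leq_trans leB).
rewrite !expnM => leE.
have : (2 * l ^ l) ^ t.*2.+1 <= (l.+1 ^ l) ^ t.*2.+1 by rewrite leq_exp2r ?double_expn.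
rewrite expnMn => /leq_trans/(_ leE); rewrite leq_pmul2r ?leq_exp2l ?ltnn //.
by rewrite !expn_gt0 l0.
Qed.

End GoodBlock.

(** * Independence, dissociated sets and the chosen block *)

Local Open Scope ring_scope.

(** Families are indexed by [nat], only the values below [k] counting, so that the inductions can
    prepend an element by matching on the index. *)
Definition mulindep (K : fieldType) k (g : nat -> K) :=
  forall n : nat -> int, \prod_(i < k) g i ^ n i = 1 ->
  forall i, (i < k)%N -> n i = 0.

Definition addindep (V : zmodType) k (g : nat -> V) :=
  forall n : nat -> int, \sum_(i < k) g i *~ n i = 0 ->
  forall i, (i < k)%N -> n i = 0.

Definition dissociated (V : nmodType) (Z : {fset V}) :=
  forall B C : {fset V}, B `<=` Z -> C `<=` Z ->
  \sum_(x <- B) x = \sum_(x <- C) x -> B = C.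

Definition quotients (K : fieldType) (P : {fset K}) k (g : nat -> K) :=
  forall i, (i < k)%N -> exists x y, [/\ x \in P, y \in P & g i = x / y].

Definition differences (V : zmodType) (P : {fset V}) k (g : nat -> V) :=
  forall i, (i < k)%N -> exists x y, [/\ x \in P, y \in P & g i = x - y].

(** The 2^|Z| subset sums of [Z] are distinct and all lie in [sumset A]. *)
Lemma dissociated_card (K : fieldType) (A Z : {fset K}) t :
  Z `<=` A -> dissociated Z -> (#|` sumset A| <= 2 ^ t)%N -> (#|` Z| <= t)%N.
Proof.
move=> ZA dZ leA; rewrite -(leq_exp2l _ _ (ltnSn 1)) -card_fpowerset.
apply: leq_trans leA.
have <- : #|` [fset \sum_(x <- B) x | B : {fset K} in fpowerset Z]| = #|` fpowerset Z|.
  apply: card_in_imfset => B C; rewrite !fpowersetE; exact: dZ.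
apply/fsubset_leq_card/fsubsetP=> _ /imfsetP[B /= + ->].
by rewrite fpowersetE => BZ; apply: in_imfset; rewrite /= fpowersetE (fsubset_trans BZ).
Qed.

(** [good_block] is applied to multiplication and addition at once. Then d + 1 independent quotients
    (or differences) would give E^(d+1) <= |B|^2 <= 2^(2t), against the last hypothesis; the choice
    of [l] makes words of length (d+1) E admissible. *)
Lemma good_piece (K : fieldType) (A : {fset K}) t d l q E :
    0 \notin A -> (0 < q)%N -> (l * t.*2.+1 * q <= #|` A|)%N ->
    (#|` sumset A| <= 2 ^ t)%N -> (#|` prodset A| <= 2 ^ t)%N ->
    (d.+1 * E <= l)%N -> (2 ^ t.*2 < E ^ d.+1)%N ->
  exists2 P : {fset K}, P `<=` A /\ #|` P| = q &
  [/\ forall g, quotients P d.+1 g -> ~ mulindep d.+1 g,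
      forall g, differences P d.+1 g -> ~ addindep d.+1 g
    & forall Z, Z `<=` P -> dissociated Z -> (#|` Z| <= t)%N].
Proof.
move=> A0 q0 leA leS leP dl tE.
have l0 : (0 < l)%N.
  by apply: leq_trans dl; rewrite muln_gt0 /=; case: E tE => //; rewrite exp0n.
pose D := [pred x : K | x != 0].
have DM : {in D &, forall x y, x * y \in D}.
  by move=> x y; rewrite !inE => x0 y0; rewrite mulf_neq0.
have DV : {in D, forall x, x^-1 \in D} by move=> x; rewrite !inE invr_eq0.
have VD : {in D, forall x, x * x^-1 = 1} by move=> x; exact: mulfV.
have AD : {subset A <= D} by move=> x Ax; rewrite inE; apply: contraNneq A0 => <-.
have NK : {in predT, forall x : K, x + - x = 0} by move=> x _; exact: subrr.
have D1 : 1 \in D by rewrite inE oner_eq0.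
have [P [B1 [B2 [PA cP [BD1 le1 G1] [BD2 le2 G2]]]]] :=
  @good_block K 1 0 *%R +%R D predT _ _ A t l q DM (fun _ _ _ _ => isT) VD NK
    D1 isT AD (fun _ _ => isT) q0 l0 leA leP leS.
have PD : {subset P <= D} by move=> x /(fsubsetP PA)/AD.
have absurd B : (E ^ d.+1 <= B ^ 2)%N -> (B <= 2 ^ t)%N -> False.
  move=> h hB; have := leq_trans h (leq_mul hB hB).
  by rewrite -expnD addnn leqNgt tE.
exists P => //; split.
- move=> g qg ig.
  have g0 i : (i < d.+1)%N -> g i != 0.
    move=> /qg[x [y [Px Py ->]]].
    by rewrite mulf_neq0 ?invr_eq0 //; apply: PD.
  apply: (absurd #|` B1|) => //.
  apply: (@independent_ratios_bound K 1 *%R _ D DM DV VD B1 P PD BD1 d.+1 E g qg).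
    move=> e f ef i id; apply/eqP; rewrite -eqz_nat -subr_eq0; apply/eqP.
    apply: (ig (fun i => (e i)%:Z - (f i)%:Z)) id.
    under eq_bigr => j _ do rewrite expfzDr ?g0 // -invr_expz -!exprnP.
    have {}ef : \prod_(i < d.+1) g i ^+ e i = \prod_(i < d.+1) g i ^+ f i.
      transitivity (\prod_(i < d.+1) iter (e i) ( *%R (g i)) 1).
        by apply: eq_bigr => j _; rewrite iter_mulr_1.
      by rewrite ef; apply: eq_bigr => j _; exact: iter_mulr_1.
    rewrite big_split /= prodfV ef mulfV //.
    by apply/prodf_neq0 => j _; rewrite expf_neq0 ?g0.
  by apply: leq_ltn_trans G1; rewrite leq_mul2r dl orbT.
- move=> g qg ig; apply: (absurd #|` B2|) => //.
  apply: (@independent_ratios_bound K 0 +%R _ predT (fun _ _ _ _ => isT)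
    (fun _ _ => isT) NK B2 P (fun _ _ => isT) BD2 d.+1 E g qg).
    move=> e f ef i id; apply/eqP; rewrite -eqz_nat -subr_eq0; apply/eqP.
    apply: (ig (fun i => (e i)%:Z - (f i)%:Z)) id.
    under eq_bigr => j _ do rewrite mulrzBr.
    have {}ef : \sum_(i < d.+1) g i *+ e i = \sum_(i < d.+1) g i *+ f i.
      transitivity (\sum_(i < d.+1) iter (e i) (+%R (g i)) 0).
        by apply: eq_bigr => j _; rewrite iter_addr_0.
      by rewrite ef; apply: eq_bigr => j _; exact: iter_addr_0.
    by rewrite sumrB /= ef subrr.
  by apply: leq_ltn_trans G2; rewrite leq_mul2r dl orbT.
by move=> Z ZP dZ; apply: (dissociated_card (fsubset_trans ZP PA)).
Qed.

(** * Valuation rings that avoid a non-integral element *)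

Definition valring (K : fieldType) (O : K -> Prop) :=
  [/\ forall x y, O x -> O y -> O (x - y), forall x y, O x -> O y -> O (x * y)
    & forall x, O x \/ O x^-1].

Section ValuationRing.

Variables (K : fieldType) (x : K).
Hypothesis xNint : ~ integralOver (intr : int -> K) x.

Let x0 : x != 0.
Proof. by apply/eqP=> x0; apply: xNint; rewrite x0; exact: integral0. Qed.

(** Subrings containing 1/x but not x. The membership of 1 and 1/x is conditional on [S] being
    nonempty, so that the empty set, which is the union of the empty chain in Zorn's lemma,
    qualifies too. *)
Let good (S : set K) :=
  [/\ forall z, S z -> S 1, forall z, S z -> S x^-1,
      forall y z, S y -> S z -> S (y - z), forall y z, S y -> S z -> S (y * z)
    & ~ S x].

(** The witness is Z[1/x]. If x = p(1/x), multiplying by x^n with n at least the degree of p gives a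
    monic integral equation of degree n + 1 for x. *)
Lemma good_base : exists2 S, good S & exists z, S z.
Proof.
exists (fun z => exists p : {poly int}, z = (map_poly intr p).[x^-1]); last first.
  by exists 0, 0; rewrite rmorph0 horner0.
split.
- by move=> _ _; exists 1; rewrite rmorph1 hornerC.
- by move=> _ _; exists 'X; rewrite map_polyX hornerX.
- by move=> _ _ [p ->] [q ->]; exists (p - q); rewrite rmorphB hornerD hornerN.
- by move=> _ _ [p ->] [q ->]; exists (p * q); rewrite rmorphM hornerM.
move=> [p xE]; apply: xNint; pose n := size p.
pose q : {poly int} := \poly_(i < n.+1) p`_(n - i).
exists ('X^(n.+1) - q).
  rewrite monicE lead_coefDl ?lead_coefXn // size_polyN size_polyXn ltnS.
  exact: size_poly.
rewrite rootE rmorphB /= map_polyXn hornerD hornerN hornerXn subr_eq0; apply/eqP.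
rewrite exprS {1}xE (@horner_coef_wide _ n.+1); last first.
  by rewrite (leq_trans (size_poly _ _)).
rewrite (@horner_coef_wide _ n.+1 (map_poly _ q)); last first.
  by rewrite (leq_trans (size_poly _ _)) // size_poly.
rewrite mulr_suml (reindex_inj rev_ord_inj) /=; apply: eq_bigr => i _.
rewrite !coef_map coef_poly ltn_ord subSS -mulrA; congr (_ * _).
by rewrite exprVn mulrC -expfB_cond ?(negPf x0) ?leq_subr // subKn // -ltnS.
Qed.

(** A maximal subring containing 1/x but not x is a valuation ring. If w and 1/w were both missing
    from it, x would be a polynomial in w and also one in 1/w, and these can be played against each
    other to lower their degrees until none is left. *)
Lemma exists_valring : exists2 O, valring O & ~ O x.
Proof.
have [|S [goodS maxS]] := @Zorn_bigcup K good.
  move=> F Fgood Ftot; split.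
  - by move=> z [X FX Xz]; exists X => //; have [h _ _ _ _] := Fgood _ FX; apply: h Xz.
  - by move=> z [X FX Xz]; exists X => //; have [_ h _ _ _] := Fgood _ FX; apply: h Xz.
  - move=> y z [X FX Xy] [Y FY Yz]; have [_ _ hX _ _] := Fgood _ FX.
    have [_ _ hY _ _] := Fgood _ FY.
    have [XY|YX] := Ftot _ _ FX FY; first by exists Y => //; apply: hY => //; apply: XY.
    by exists X => //; apply: hX => //; apply: YX.
  - move=> y z [X FX Xy] [Y FY Yz]; have [_ _ _ hX _] := Fgood _ FX.
    have [_ _ _ hY _] := Fgood _ FY.
    have [XY|YX] := Ftot _ _ FX FY; first by exists Y => //; apply: hY => //; apply: XY.
    by exists X => //; apply: hX => //; apply: YX.
  - by move=> [X FX Xx]; have [_ _ _ _] := Fgood _ FX; apply.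
have [S0 gS0 [z0 S0z0]] := good_base.
have [z Sz] : exists z, S z.
  apply: contrapT => Se; apply: (maxS S0) => //; split.
    by move=> y Sy; case: Se; exists y.
  by move=> SS0; apply: Se; exists z0; apply: SS0.
have [S1' Sy' SB SM Sx] := goodS; have S1 := S1' _ Sz; have Sy := Sy' _ Sz.
have S0' : S 0 by rewrite -(subrr 1); apply: SB.
have SD a b : S a -> S b -> S (a + b).
  by move=> Sa Sb; rewrite -[b]opprK -(sub0r b); apply: (SB) => //; apply: SB.
have Ssum (I : Type) (r : seq I) (F : I -> K) : (forall i, S (F i)) -> S (\sum_(i <- r) F i).
  by move=> SF; exact: (big_ind S S0' SD (fun i _ => SF i)).
(* By maximality, adjoining any missing element w to [S] produces x. *)
have adj w : ~ S w -> exists2 p : {poly K}, (forall i, S p`_i) & x = p.[w].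
  move=> Sw; apply: contrapT => h.
  pose Sw' : set K := fun v => exists2 p : {poly K}, (forall i, S p`_i) & v = p.[w].
  have SC c : S c -> Sw' c.
    by move=> Sc; exists c%:P; [move=> i; rewrite coefC; case: eqP|rewrite hornerC].
  apply: (maxS Sw'); first split.
  - exact: SC.
  - by move=> sub; apply: Sw; apply: sub; exists 'X; [move=> i; rewrite coefX; case: eqP|rewrite hornerX].
  split.
  - by move=> _ _; apply: SC.
  - by move=> _ _; apply: SC.
  - move=> _ _ [p Sp ->] [q Sq ->]; exists (p - q); last by rewrite hornerD hornerN.
    by move=> i; rewrite coefB; apply: SB.
  - move=> _ _ [p Sp ->] [q Sq ->]; exists (p * q); last by rewrite hornerM.
    by move=> i; rewrite coefM; apply: Ssum => j; apply: SM.
  - by [].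
(* 1/x lies in the Jacobson radical. With e = 1 - s/x, if 1/e were missing then x would be a
   polynomial in 1/e, so x e^n is in [S] for large n; but e^n = 1 - s'/x, so x e^n = x - s' and x
   would be in [S]. *)
have unit s : S s -> S (1 - x^-1 * s)^-1.
  move=> Ss; apply: contrapT => /adj[p Sp xE]; set e := 1 - _ in xE.
  have e0 : e != 0.
    apply: contra_not_neq Sx => /eqP; rewrite subr_eq0 => /eqP e0.
    by rewrite -(mulr1 x) e0 mulVKf.
  have epow n : exists2 s', S s' & e ^+ n = 1 - x^-1 * s'.
    elim: n => [|n [s' Ss' IH]]; first by exists 0; rewrite // mulr0 subr0.
    exists (s + s' - s * (x^-1 * s')).
      by apply: (SB); [apply: SD|apply: (SM) => //; apply: SM].
    by rewrite exprS IH /e; ring.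
  have Se : S e by apply: SB => //; apply: SM.
  have SX n : S (e ^+ n) by elim: n => // n IH; rewrite exprS; apply: SM.
  have [s' Ss' eE] := epow (size p).
  apply: Sx; rewrite (_ : x = x * e ^+ size p + s'); last first.
    by rewrite eE mulrBr mulr1 mulVKf // subrK.
  apply: SD => //; rewrite {1}xE horner_coef mulr_suml; apply: Ssum => i.
  rewrite -mulrA; apply: SM => //.
  by rewrite exprVn mulrC -expfB_cond ?(negPf e0) //= add0n ltnW ?ltn_ord.
pose reach n w := exists2 p : {poly K}, (forall i, S p`_i) & (size p <= n)%N /\ x = p.[w].
(* Take m <= n. In x = q(1/w) the constant term moves to the left, giving x e with e = 1 - q_0/x a
   unit. Multiplied by w^n, the equation expresses w^n through lower powers of w, which removes the
   leading term of p. *)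
have main N n m w : w != 0 -> reach n w -> reach m w^-1 -> (n + m < N)%N -> False.
  elim: N n m w => // N IH n m w w0 rn rm nmN.
  wlog mn : n m w w0 rn rm nmN / (m <= n)%N.
    move=> W; have [|nm] := leqP m n; first exact: W rn rm nmN.
    apply: (W m n w^-1) => //; rewrite ?invr_eq0 ?invrK //; last exact: ltnW.
    by rewrite addnC.
  have [p Sp [sp xp]] := rn; have [q Sq [sq xq]] := rm.
  case: n => [|n] in rn nmN mn sp.
    by move: sp x0; rewrite leqn0 size_poly_eq0 xp => /eqP->; rewrite horner0 eqxx.
  pose e := 1 - x^-1 * q`_0.
  have e0 : e != 0.
    apply: contra_not_neq Sx => /eqP; rewrite subr_eq0 => /eqP e0.
    by rewrite -(mulr1 x) e0 mulVKf.
  have Se := unit _ (Sq 0%N).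
  pose c := p`_n * x^-1 * e^-1.
  have Sc : S c by apply: (SM) => //; apply: SM.
  apply: (IH n m w) => //; exists (\poly_(i < n) (p`_i + c * q`_(n - i))).
    by move=> i; rewrite coef_poly; case: ifP => // _; apply: SD => //; apply: SM.
  split; first exact: size_poly.
  rewrite horner_poly; under eq_bigr do rewrite mulrDl -mulrA.
  rewrite big_split /= -mulr_sumr.
  have -> : \sum_(i < n) q`_(n - i) * w ^+ i = w ^+ n * (x * e).
    rewrite mulrBr mulr1 mulVKf // {1}xq (horner_coef_wide _ (leq_trans sq mn)).
    rewrite big_ord_recl expr0 mulr1 addrC addKr mulr_sumr.
    rewrite (reindex_inj rev_ord_inj) /=; apply: eq_bigr => i _.
    rewrite subKn // mulrCA /bump /= add1n exprVn; congr (_ * _).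
    by rewrite -expfB_cond ?(negPf w0) ?add0n ?ltn_ord.
  rewrite {1}xp (horner_coef_wide _ sp) big_ord_recr /=; congr (_ + _).
  by rewrite /c; field; rewrite x0 e0.
exists S => //; split=> // w; apply: contrapT => /not_orP[Sw SwV].
have w0 : w != 0 by apply/eqP=> w0; apply: Sw; rewrite w0.
have [p Sp xp] := adj _ Sw; have [q Sq xq] := adj _ SwV.
by apply: (main _ (size p) (size q) w w0) => //; [exists p|exists q].
Qed.

End ValuationRing.

(** * Large classes and vanishing signed sums *)

(** Greedy choice: pick x, discard everything close to x, repeat. The chosen points are pairwise not
    close, so there are at most [t] of them, and one of their neighbourhoods has at least |P|/t
    elements. As [close] may fail to be transitive, two elements of the result are only related
    through a common neighbour. *)
Lemma large_class (T : choiceType) (P : {fset T}) (close : rel T) t :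
    reflexive close -> symmetric close ->
    (forall Z : {fset T}, Z `<=` P ->
      {in Z &, forall x y, close x y -> x = y} -> (#|` Z| <= t)%N) ->
  exists P' : {fset T}, [/\ P' `<=` P, (#|` P| <= t * #|` P'|)%N
    & {in P' &, forall y z, exists x, [/\ x \in P, close x y & close x z]}].
Proof.
move=> rc sc bound.
have [->|P0] := eqVneq P fset0.
  by exists fset0; split; rewrite ?fsub0set ?cardfs0.
pose C x := [fset y in P | close x y].
have [[x Px big]|small] := pselect (exists2 x, x \in P & (#|` P| <= t * #|` C x|)%N).
  exists (C x); split=> //; first by apply/fsubsetP=> y; rewrite !inE => /andP[].
  by move=> y z; rewrite !inE => /andP[_ cy] /andP[_ cz]; exists x.
(* The largest size a neighbourhood can have when [t] times it is less than |P|; then t m < |P| is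
   the contradiction. *)
pose m := ((#|` P|).-1 %/ t)%N.
have cover Q : Q `<=` P -> exists2 Z : {fset T}, Z `<=` Q &
    {in Z &, forall x y, close x y -> x = y} /\ (#|` Q| <= #|` Z| * m)%N.
  have [N] := ubnP #|` Q|; elim: N Q => // N IH Q leN QP.
  have [->|/fset0Pn[x Qx]] := eqVneq Q fset0; first by exists fset0; rewrite ?cardfs0.
  pose Q1 := [fset y in Q | ~~ close x y].
  have Q1Q : Q1 `<=` Q by apply/fsubsetP=> y; rewrite !inE => /andP[].
  have xQ1 : x \notin Q1 by rewrite !inE rc andbF.
  have lt1 : (#|` Q1| < N)%N.
    rewrite -ltnS; apply: leq_trans leN; rewrite ltnS; apply: fproper_ltn_card.
    by rewrite fproperE Q1Q; apply/negP => /fsubsetP/(_ _ Qx); rewrite (negPf xQ1).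
  have [Z ZQ1 [nZ leZ]] := IH _ lt1 (fsubset_trans Q1Q QP).
  have xZ z : z \in Z -> ~~ close x z by move=> /(fsubsetP ZQ1); rewrite !inE => /andP[].
  exists (x |` Z).
    by rewrite fsubUset fsub1set Qx (fsubset_trans ZQ1).
  split.
    move=> y z; rewrite !in_fset1U => /predU1P[->|Zy] /predU1P[->|Zz] //.
    - by rewrite (negPf (xZ _ Zz)).
    - by rewrite sc (negPf (xZ _ Zy)).
    - exact: nZ.
  rewrite cardfsU1 (contra (fsubsetP ZQ1 x)) // mulnDl mul1n.
  apply: (@leq_trans (#|` C x| + #|` Q1|)).
    have {1}-> : Q = (Q `&` C x) `|` Q1.
      apply/fsetP=> y; rewrite !inE; case Qy: (y \in Q) => //=.
      by rewrite (fsubsetP QP _ Qy) orbN.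
    apply: leq_trans (leq_card_fsetU _ _) _.
    by rewrite leq_add2r; exact/fsubset_leq_card/fsubsetIr.
  apply: leq_add leZ.
  have xC : x \in C x by rewrite !inE (fsubsetP QP) //= rc.
  have t0 : (0 < t)%N.
    have := bound [fset x]; rewrite fsub1set (fsubsetP QP) // cardfs1; apply=> //.
    by move=> y z; rewrite !inE => /eqP-> /eqP->.
  rewrite /m leq_divRL //.
  have : ~ (#|` P| <= t * #|` C x|)%N.
    by move=> h; apply: small; exists x; rewrite ?(fsubsetP QP).
  by move/negP; rewrite -ltnNge mulnC; case: #|` P|.
have [Z ZP [nZ leZ]] := cover P (fsubset_refl P).
have := leq_trans leZ (leq_mul (bound Z ZP nZ) (leqnn m)).
rewrite mulnC => /leq_trans/(_ (leq_trunc_div _ _)).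
by move: P0; rewrite -cardfs_gt0; case: #|` P| => // n _; rewrite ltnn.
Qed.

(** Cancelling the common part of two equal subset sums leaves a vanishing signed sum over their
    symmetric difference. *)
Lemma dissociated_signed (K : pzRingType) (Z : {fset K}) :
    (forall Y : {fset K}, Y `<=` Z -> Y != fset0 -> forall s : K -> bool,
      \sum_(y <- Y) (-1) ^+ s y * y != 0) ->
  dissociated Z.
Proof.
move=> H B C BZ CZ BC; apply/eqP/negPn/negP=> nBC.
pose Y := (B `\` C) `|` (C `\` B).
have Y0 : Y != fset0.
  apply: contra nBC; rewrite fsetU_eq0 !fsetD_eq0 => /andP[h1 h2].
  by rewrite eqEfsubset h1.
have YZ : Y `<=` Z by rewrite fsubUset !(fsubset_trans (fsubsetDl _ _)).
have /eqP := H Y YZ Y0 (fun x => x \in C); apply.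
move: BC; rewrite (big_fsetID _ (mem C) B) (big_fsetID _ (mem B) C) /=.
have -> : [fset x in B | x \in C] = [fset x in C | x \in B].
  by apply/fsetP=> x; rewrite !inE andbC.
move/addrI => BC; rewrite (big_fsetID _ (mem C) Y) /=.
have -> : [fset x in Y | x \in C] = [fset x in C | x \notin B].
  by apply/fsetP=> x; rewrite !inE; case: (x \in B); case: (x \in C).
have -> : [fset x in Y | x \notin C] = [fset x in B | x \notin C].
  by apply/fsetP=> x; rewrite !inE; case: (x \in B); case: (x \in C).
rewrite (eq_big_seq (fun x => - x)) => [|x]; last first.
  by rewrite !inE /= => /andP[-> _]; rewrite expr1 mulN1r.
rewrite [X in _ + X](eq_big_seq id) => [|x]; last first.
  by rewrite !inE /= => /andP[_ /negPf->]; rewrite expr0 mul1r.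
by rewrite BC sumrN addNr.
Qed.

(** * Descent along valuation rings to integral quotients *)

Section Valring.

Variables (K : fieldType) (O : K -> Prop).
Hypothesis vO : valring O.

Let OB x y : O x -> O y -> O (x - y). Proof. by case: vO => h _ _; apply: h. Qed.
Let OM x y : O x -> O y -> O (x * y). Proof. by case: vO => _ h _; apply: h. Qed.
Let OV x : O x \/ O x^-1. Proof. by case: vO => _ _; apply. Qed.
Let O1 : O 1. Proof. by have [] := OV 1; rewrite ?invr1. Qed.
Let O0 : O 0. Proof. by rewrite -(subrr 1); apply: OB. Qed.
Let OD x y : O x -> O y -> O (x + y).
Proof. by move=> Ox Oy; rewrite -[y]opprK -(sub0r y); apply: (OB) => //; apply: OB. Qed.
Let ON x : O x -> O (- x). Proof. by rewrite -sub0r => Ox; apply: OB. Qed.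

(* [vunit 0] may hold, since [0^-1 = 0]. *)
Definition vunit x := O x /\ O x^-1.

Lemma vunit_div x y : vunit x -> vunit y -> vunit (x / y).
Proof. by move=> [Ox OVx] [Oy OVy]; split; rewrite ?invf_div; apply: OM. Qed.

Lemma vunitV x : vunit x -> vunit x^-1.
Proof. by move=> [Ox OVx]; split; rewrite ?invrK. Qed.

Lemma vunit1 : vunit 1. Proof. by split; rewrite ?invr1. Qed.

Lemma vunitM x y : vunit x -> vunit y -> vunit (x * y).
Proof. by move=> ux /vunitV uy; rewrite -[y]invrK; apply: vunit_div. Qed.

Lemma vunitX x (n : int) : vunit x -> vunit (x ^ n).
Proof.
have X m y : vunit y -> vunit (y ^+ m).
  by move=> uy; elim: m => [|m IH]; [exact: vunit1|rewrite exprS; apply: vunitM].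
by move=> ux; case: n => n; [apply: X|rewrite NegzE -invr_expz; apply/vunitV/X].
Qed.

(** If x is missing then 1/x is in [O], and x = x^(m+1) (1/x)^m would put x in [O] as soon as a
    positive power of x were there. *)
Lemma notin_vunitX x (n : int) : ~ O x -> vunit (x ^ n) -> n = 0.
Proof.
move=> Ox un; have {un} : vunit (x ^+ `|n|%N).
  case: n un => n; rewrite ?absz_nat // NegzE -invr_expz => /vunitV.
  by rewrite invrK abszN.
case E: `|n|%N => [|m] [Oxm _]; first by apply/eqP; rewrite -absz_eq0 E.
case: Ox; have [//|OVx] := OV x.
have [->//|x0] := eqVneq x 0.
suff -> : x = x ^+ m.+1 * x^-1 ^+ m.
  apply: OM => //; elim: m {Oxm E} => [|m IH]; first by rewrite expr0.
  by rewrite exprS; apply: OM.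
by rewrite exprS -mulrA -exprMn mulfV // expr1n mulr1.
Qed.

(* Among pairwise distinct valuations, the term of least valuation cannot cancel. *)
Lemma valring_dissociated (Z : {fset K}) : 0 \notin Z ->
  {in Z &, forall x y, vunit (x / y) -> x = y} -> dissociated Z.
Proof.
move=> Z0 nu; apply: dissociated_signed => Y YZ Y0 s; apply/eqP=> sum0.
have nz y : y \in Y -> y != 0 by move=> Yy; apply: contraNneq Z0 => <-; apply: (fsubsetP YZ).
have [M YM maxM] : exists2 M, M \in Y & forall y, y \in Y -> O (y / M).
  have max (Y' : {fset K}) : Y' `<=` Y -> Y' != fset0 ->
      exists2 M, M \in Y' & forall y, y \in Y' -> O (y / M).
    have [N] := ubnP #|` Y'|; elim: N Y' => // N IH Y' leN Y'Y /fset0Pn[x Y'x].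
    have x0 := nz _ (fsubsetP Y'Y _ Y'x).
    have [e|ne] := eqVneq (Y' `\ x) fset0.
      exists x => // y Y'y; have : y \notin Y' `\ x by rewrite e.
      by rewrite !inE Y'y andbT negbK => /eqP->; rewrite mulfV.
    have [|||M] := IH (Y' `\ x) => //.
    - by move: leN; rewrite (cardfsD1 x) Y'x; lia.
    - by rewrite (fsubset_trans _ Y'Y) // fsubsetDl.
    rewrite !inE => /andP[_ Y'M] maxM; have M0 := nz _ (fsubsetP Y'Y _ Y'M).
    have [OxM|] := OV (x / M).
      exists M => // y Y'y; have [->//|yx] := eqVneq y x.
      by apply: maxM; rewrite !inE yx.
    rewrite invf_div => OMx; exists x => // y Y'y.
    have [->|yx] := eqVneq y x; first by rewrite mulfV.
    suff -> : y / x = (y / M) * (M / x) by apply: OM => //; apply: maxM; rewrite !inE yx.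
    by rewrite mulrA divfK.
  exact: max.
have M0 := nz _ YM.
(* The maximal ideal of [O]. Zero is listed apart because its formal inverse is 0, which lies in
   [O]. *)
pose mm w := w = 0 \/ ~ O w^-1.
have mmN a : mm a -> mm (- a).
  move=> [->|na]; [by left; rewrite oppr0|right; rewrite invrN => /ON].
  by rewrite opprK.
have mmD a b : mm a -> mm b -> mm (a + b).
  move=> [->|na]; first by rewrite add0r.
  move=> [->|nb]; first by rewrite addr0; right.
  have [->|a0] := eqVneq a 0; first by rewrite add0r; right.
  have [->|b0] := eqVneq b 0; first by rewrite addr0; right.
  have [ab0|ab0] := eqVneq (a + b) 0; [by left|right=> Oab].
  have [Oq|] := OV (a / b).
    apply: nb; suff -> : b^-1 = (1 + a / b) * (a + b)^-1 by apply: OM => //; apply: OD.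
    by field; rewrite ab0 b0.
  rewrite invf_div => Oq; apply: na.
  suff -> : a^-1 = (1 + b / a) * (a + b)^-1 by apply: OM => //; apply: OD.
  by field; rewrite ab0 a0.
(* Divided by the term [M] of least valuation, the relation says that a sum of elements of the
   maximal ideal is 1 or -1. *)
have sumO : \sum_(y <- Y `\ M) (-1) ^+ s y * (y / M) = - (-1) ^+ s M.
  apply: (mulIf M0); rewrite mulr_suml.
  under eq_bigr do rewrite -mulrA divfK //.
  apply/eqP; rewrite -subr_eq0 mulNr opprK addrC.
  by move: sum0; rewrite (big_fsetD1 M) // => ->.
have : mm (\sum_(y <- Y `\ M) (-1) ^+ s y * (y / M)).
  rewrite big_seq; apply: (big_ind mm) => [|//|y]; first by left.
  rewrite !inE => /andP[yM Yy].
  have mmy : mm (y / M).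
    right=> Oy; case/negP: yM; apply/eqP; apply: nu; rewrite ?(fsubsetP YZ) //.
    by split=> //; apply: maxM.
  by case: (s y); rewrite ?mulN1r ?mul1r //; apply: mmN.
rewrite sumO; case=> [/eqP|]; first by rewrite oppr_eq0 signr_eq0.
by apply; case: (s M); rewrite ?expr0 ?expr1 ?opprK ?invrN ?invr1 //; apply: ON.
Qed.

End Valring.

(** Induction on [k]. A non-integral quotient x/y lies outside some valuation ring; passing to a
    class whose quotients are all units there costs a factor [t]. In a relation between x/y and such
    units the exponent of x/y must vanish, so x/y can be prepended to an independent family found
    inside the class. *)
Lemma integral_quotients (K : fieldType) (t k : nat) (P : {fset K}) :
    0 \notin P -> (0 < t)%N ->
    (forall Z : {fset K}, Z `<=` P -> dissociated Z -> (#|` Z| <= t)%N) ->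
  (exists P' : {fset K}, [/\ P' `<=` P, (#|` P| <= t ^ k * #|` P'|)%N
     & {in P' &, forall x y, integralOver (intr : int -> K) (x / y)}])
  \/ exists2 g, quotients P k g & mulindep k g.
Proof.
elim: k P => [|k IH] P P0 t0 bound; first by right; exists (fun=> 1).
have [intP|] := pselect {in P &, forall x y, integralOver (intr : int -> K) (x / y)}.
  left; exists P; split=> //; by rewrite leq_pmull // expn_gt0 t0.
move=> /existsNP[x /existsNP[y nint]].
have [[Px Py] nxy] : (x \in P /\ y \in P) /\ ~ integralOver (intr : int -> K) (x / y).
  by split; [split; apply: contrapT => h; apply: nint|move=> h; apply: nint].
have nz z : z \in P -> z != 0 by move=> Pz; apply: contraNneq P0 => <-.
have [O vO Oxy] := exists_valring nxy.
have [||Z ZP nZ|P1 [P1P leP sameP]] := 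
  @large_class K P (fun z w => `[< vunit O (z / w) >] || (z == w)) t.
- by move=> z; rewrite eqxx orbT.
- move=> z w; rewrite [z == w]eq_sym; congr (_ || _).
  by apply/asboolP/asboolP => u; rewrite -invf_div; exact: vunitV u.
- apply: bound => //; apply: (valring_dissociated vO).
    by apply: contra P0; exact: (fsubsetP ZP).
  by move=> z w Zz Zw u; apply: nZ => //; rewrite asboolT.
have P10 : 0 \notin P1 by apply: contra P0; exact: (fsubsetP P1P).
have u1 z w : z \in P1 -> w \in P1 -> vunit O (z / w).
  move=> Pz Pw; have [z0 w0] := (nz _ (fsubsetP P1P _ Pz), nz _ (fsubsetP P1P _ Pw)).
  have [v [/nz v0 + +]] := sameP _ _ Pz Pw.
  have tou a b : b != 0 -> `[< vunit O (a / b) >] || (a == b) -> vunit O (a / b).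
    by move=> b0 /orP[/asboolP//|/eqP->]; rewrite mulfV //; exact: vunit1.
  move=> /(tou _ _ z0) u /(tou _ _ w0) u'.
  have -> : z / w = (v / w) / (v / z) by field; rewrite v0 w0 z0.
  exact: vunit_div.
have [|//|Z ZP1|[P2 [P2P1 leP1 intP2]]|[g qg ig]] := IH P1 => //.
- by apply: bound; apply: fsubset_trans P1P.
- left; exists P2; split=> //; first exact: fsubset_trans P1P.
  by apply: leq_trans leP _; rewrite expnS -mulnA leq_mul2l leP1 orbT.
right; exists (fun i => if i is j.+1 then g j else x / y).
  case=> [_|i /qg[z [w [Pz Pw ->]]]]; first by exists x, y.
  by exists z, w; rewrite !(fsubsetP P1P).
have ug i : (i < k)%N -> vunit O (g i).
  by move=> /qg[z [w [Pz Pw ->]]]; apply: u1.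
have g0 i : (i < k)%N -> g i != 0.
  move=> /qg[z [w [Pz Pw ->]]].
  by rewrite mulf_neq0 ?invr_eq0 ?nz ?(fsubsetP P1P).
move=> n; rewrite big_ord_recl /=.
set R := \prod_(i < k) _ => e.
have R0 : R != 0 by apply/prodf_neq0 => i _; exact/expfz_neq0/g0/ltn_ord.
have uR : vunit O R.
  apply: (big_ind (vunit O)) => [|a b ua ub|i _]; first exact: vunit1.
    exact: vunitM.
  exact/(vunitX vO)/ug/ltn_ord.
have n0 : n 0%N = 0.
  apply: (notin_vunitX vO Oxy).
  by rewrite (_ : (x / y) ^ n 0%N = R^-1) ?(canRL (mulfK R0) e) ?mul1r //; exact: vunitV.
move: e; rewrite n0 expr0z mul1r => e [|i] // ik.
exact: (ig (fun i => n i.+1) e i).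
Qed.

(** * Absolute values and descent along places *)

Definition absval (L : fieldType) (F : realFieldType) (v : L -> F) :=
  [/\ forall x, 0 <= v x, forall x, (v x == 0) = (x == 0),
      forall x y, v (x * y) = v x * v y & forall x y, v (x + y) <= v x + v y].

Section AbsoluteValue.

Variables (L : fieldType) (F : realFieldType) (v : L -> F).
Hypothesis av : absval v.

Lemma absval_ge0 x : 0 <= v x. Proof. by case: av. Qed.

Lemma absvalM x y : v (x * y) = v x * v y. Proof. by case: av. Qed.

Lemma absvalD x y : v (x + y) <= v x + v y. Proof. by case: av. Qed.

Lemma absval_eq0 x : (v x == 0) = (x == 0). Proof. by case: av. Qed.

Lemma absval_gt0 x : x != 0 -> 0 < v x.
Proof. by move=> x0; rewrite lt_neqAle absval_ge0 andbT eq_sym absval_eq0. Qed.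

Lemma absval0 : v 0 = 0. Proof. by apply/eqP; rewrite absval_eq0. Qed.

Lemma absval1 : v 1 = 1.
Proof.
have v1 : v 1 != 0 by rewrite absval_eq0 oner_eq0.
by apply: (mulfI v1); rewrite -absvalM !mulr1.
Qed.

Lemma absvalV x : v x^-1 = (v x)^-1.
Proof.
have [->|x0] := eqVneq x 0; first by rewrite invr0 absval0 invr0.
by apply: (@mulfI _ (v x)); rewrite ?absval_eq0 // -absvalM !mulfV ?absval_eq0 ?absval1.
Qed.

Lemma absvalX x n : v (x ^+ n) = v x ^+ n.
Proof. by elim: n => [|n IH]; rewrite ?expr0 ?absval1 // !exprS absvalM IH. Qed.

Lemma absval_sign s x : v ((-1) ^+ s * x) = v x.
Proof.
suff v1 : v (-1) = 1 by rewrite absvalM absvalX v1 expr1n mul1r.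
have : v (-1) ^+ 2 = 1 by rewrite -absvalX sqrrN expr1n absval1.
by move/eqP; rewrite sqrf_eq1 => /orP[/eqP//|/eqP e]; have := absval_ge0 (-1); rewrite e oppr_ge0 ler10.
Qed.

Lemma absval_sum (T : eqType) (r : seq T) (f : T -> L) :
  v (\sum_(x <- r) f x) <= \sum_(x <- r) v (f x).
Proof.
elim: r => [|x r IH]; first by rewrite !big_nil absval0.
by rewrite !big_cons (le_trans (absvalD _ _)) // lerD2l.
Qed.

(** The equality keeps the relation reflexive at 0, as [large_class] asks. *)
Definition comparable2 x y := (x == y) || ((v x < 2 * v y) && (v y < 2 * v x)).

(* Sizes at least double from one element to the next, so the largest one exceeds
   the sum of the others. *)
Lemma lacunary_dissociated (Z : {fset L}) : 0 \notin Z ->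
  {in Z &, forall x y, comparable2 x y -> x = y} -> dissociated Z.
Proof.
move=> Z0 nc; apply: dissociated_signed => Y YZ Y0 s; apply/eqP=> sum0.
suff [M YM lt] : exists2 M, M \in Y & \sum_(y <- Y `\ M) v y < v M.
  move: sum0; rewrite (big_fsetD1 M) //= => /eqP; rewrite addr_eq0 => /eqP e.
  move: lt; rewrite -(absval_sign (s M)) e ltNge -(absval_sign 1) expr1 mulN1r opprK.
  rewrite (le_trans (absval_sum _ _)) // le_eqVlt; apply/orP; left; apply/eqP.
  by apply: eq_bigr => y _; rewrite absval_sign.
have [N] := ubnP #|` Y|; elim: N Y YZ Y0 {sum0} => // N IH Y YZ Y0 leN.
have pos y : y \in Y -> 0 < v y.
  by move=> Yy; apply: absval_gt0; apply: contraNneq Z0 => <-; apply: (fsubsetP YZ).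
have [M YM maxM] : exists2 M, M \in Y & forall y, y \in Y -> v y <= v M.
  have /fset0Pn[x Yx] := Y0.
  have [M _ maxM] := @Order.TotalTheory.arg_maxP _ _ Y [` Yx] predT (fun y => v (val y)) isT.
  by exists (val M) => [|y Yy]; [exact: valP|exact: (maxM [` Yy])].
exists M => //; have [->|Y1] := eqVneq (Y `\ M) fset0.
  by rewrite big_seq_fset0 pos.
have [|||M' Y1M' lt] := IH (Y `\ M) => //.
- by rewrite (fsubset_trans _ YZ) ?fsubsetDl.
- by move: leN; rewrite (cardfsD1 M) YM; lia.
move: (Y1M'); rewrite !inE => /andP[M'M YM'].
rewrite (big_fsetD1 M') //=.
have := nc _ _ (fsubsetP YZ _ YM') (fsubsetP YZ _ YM).
rewrite /comparable2 (negPf M'M) /=; have := maxM _ YM'; have := pos _ YM; have := pos _ YM'.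
move=> p1 p2 le12 h.
have {}h : 2 * v M' <= v M.
  rewrite leNgt; apply/negP => lt2; case/negP: M'M; apply/eqP/h; rewrite lt2 andbT.
  by lra.
by lra.
Qed.

End AbsoluteValue.

Section Places.

Variables (L : fieldType) (F : realFieldType) (I : finType) (v : I -> L -> F).
Hypothesis av : forall i, absval (v i).

(** Each [g i] is huge at its own place [s i], where it dominates itself and its inverse at all
    places, while the later elements are nearly 1 there. The 4 arises because two elements within a
    factor 2 of a common one have a quotient at most 4. *)
Definition place_chain (R : F) k (s : nat -> I) (g : nat -> L) :=
  [/\ forall i, (i < k)%N -> R < v (s i) (g i),
      forall i, (i < k)%N -> forall j, v j (g i) <= v (s i) (g i),
      forall i, (i < k)%N -> forall j, v j (g i)^-1 <= v (s i) (g i)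
    & forall i j, (i < j < k)%N -> v (s i) (g j) <= 4 /\ v (s i) (g j)^-1 <= 4].

Lemma sum_expn2 i k : (i <= k)%N -> (\sum_(j < k) (if (j < i)%N then 2 ^ j else 0) < 2 ^ i)%N.
Proof.
move=> ik; rewrite -big_mkcond /= (big_ord_narrow ik) /=.
by elim: i {ik} => [|i IH]; rewrite ?big_ord0 // big_ord_recr /= expnS; lia.
Qed.

(* The matrix of the log |g_j|_(s_i), with columns scaled by their largest entry,
   is nearly lower triangular with unit diagonal. *)
Lemma place_chain_mulindep Q k s g :
  (k * 2 ^ k < Q)%N -> place_chain (4 ^+ Q) k s g -> mulindep k g.
Proof.
move=> ltQ [big1 maxg maxV small] n prod1 i0 i0k; apply/eqP/negPn/negP=> ni0.
pose rho j := v (s j) (g j); pose T (j : 'I_k) := rho j ^+ `|n j|%N.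
have R1 : 1 <= 4 ^+ Q :> F by apply: exprn_ege1; lra.
have rho1 (j : 'I_k) : 1 < rho j by apply: le_lt_trans R1 (big1 _ _).
have T1 (j : 'I_k) : 1 <= T j by apply/exprn_ege1/ltW.
have g0 (j : 'I_k) : g j != 0.
  by rewrite -(absval_eq0 (av (s j))) gt_eqF //; apply: lt_trans (rho1 j).
have [j0 _ maxT] := @Order.TotalTheory.arg_maxP _ _ 'I_k (Ordinal i0k) predT T isT.
set M := T j0 in maxT.
have M1 : 1 < M.
  apply: lt_le_trans (maxT (Ordinal i0k) isT); rewrite /T /=.
  by rewrite exprn_egt1 ?(rho1 (Ordinal i0k)) // absz_eq0.
have M0 : 0 < M := lt_trans ltr01 M1.
(* Solve the relation for the term i and measure it at [s i]. A factor j < i contributes at most T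
   j, bounded by induction; a factor j > i at most 4^|n_j|, whose Q-th power is at most T j <= M.
   The exponents of M add up to k (1 + sum of 2^j over j < i) <= k 2^i. *)
have key (i : 'I_k) : T i ^+ Q <= M ^+ (k * 2 ^ i).
  have [m] := ubnP (i : nat); elim: m i => // m IH i lem.
  pose b (j : 'I_k) := if (j < i)%N then T j else if j == i then 1 else 4 ^+ `|n j|%N.
  have Tb : T i <= \prod_(j < k) b j.
    have bnd (j : 'I_k) e : j != i -> `|e|%N = `|n j|%N -> v (s i) (g j ^ e) <= b j.
      (* One bound c serves for both g j and its inverse, so the sign of the exponent does not
         matter. *)
      move=> ji en; have [c [gc gVc cb]] : exists c,
          [/\ v (s i) (g j) <= c, v (s i) (g j)^-1 <= c & c ^+ `|n j|%N = b j].
        rewrite /b (negPf ji); case: ltnP => [lt|].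
          by exists (rho j); split=> //; [exact: maxg|exact: maxV].
        rewrite leq_eqVlt eq_sym (inj_eq val_inj) (negPf ji) /= => lt.
        exists 4; have [|h1 h2] := small i j; first by rewrite lt ltn_ord.
        by split.
      have pw x p : v (s i) x <= c -> v (s i) (x ^+ p) <= c ^+ p.
        by move=> xc; rewrite (absvalX (av _)); apply: lerXn2r;
          rewrite ?nnegrE ?(le_trans _ xc) ?(absval_ge0 (av _)).
      rewrite -cb -en; case: e {en} => e /=; first exact: pw.
      by rewrite NegzE -exprz_inv; exact: pw.
    have prodb e : (forall j : 'I_k, `|e j|%N = `|n j|%N) ->
        v (s i) (\prod_(j < k | j != i) g j ^ e j) <= \prod_(j < k) b j.
      move=> en; rewrite [leRHS](bigD1 i) //= {1}/b ltnn eqxx mul1r.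
      rewrite (big_morph _ (absvalM (av _)) (absval1 (av _))).
      by apply: ler_prod => j ji; rewrite (absval_ge0 (av _)) /= bnd ?en.
    have gi : g i ^ n i * \prod_(j < k | j != i) g j ^ n j = 1.
      by move: prod1; rewrite (bigD1 i).
    have P0 : \prod_(j < k | j != i) g j ^ n j != 0.
      by apply/prodf_neq0 => j _; exact/expfz_neq0/g0.
    have -> : T i = v (s i) (g i ^+ `|n i|%N) by rewrite (absvalX (av _)).
    case: (n i) gi => e gi /=.
      rewrite exprnP (_ : g i ^ e = \prod_(j < k | j != i) g j ^ (- n j)) ?prodb //.
        by move=> j; rewrite abszN.
      rewrite (canRL (mulfK P0) gi) mul1r -prodfV.
      by apply: eq_bigr => j _; rewrite invr_expz.
    rewrite (_ : _ ^+ _ = \prod_(j < k | j != i) g j ^ n j) ?prodb //.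
    apply: (@mulfI _ (g i ^ Negz e)); first exact: expfz_neq0.
    by rewrite gi NegzE -invr_expz mulVf // expf_neq0.
  have b0 j : 0 <= b j.
    rewrite /b; case: ifP => _; first by rewrite ltW ?(lt_le_trans _ (T1 j)).
    by case: ifP => _ //; rewrite exprn_ge0.
  pose c (j : 'I_k) := (k * (if (j < i)%N then 2 ^ j else 0) + 1)%N.
  have bc j : b j ^+ Q <= M ^+ c j.
    rewrite /b /c; case: ifP => [ji|_].
      rewrite exprD expr1; apply: le_trans (IH _ _) _; first exact: leq_trans ji lem.
      exact: ler_peMr (exprn_ge0 _ (ltW M0)) (ltW M1).
    rewrite muln0 add0n expr1; case: eqP => [_|_]; first by rewrite expr1n ltW.
    rewrite exprAC; apply: le_trans (maxT j isT).
    by apply: lerXn2r; rewrite ?nnegrE ?exprn_ge0 ?(absval_ge0 (av _)) ?ltW ?big1.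
  apply: (@le_trans _ _ (\prod_(j < k) b j ^+ Q)).
    by rewrite prodrXl; apply: lerXn2r; rewrite ?nnegrE ?prodr_ge0 // (le_trans ler01 (T1 i)).
  apply: (@le_trans _ _ (\prod_(j < k) M ^+ c j)).
    by apply: ler_prod => j _; rewrite exprn_ge0 //= bc.
  rewrite prodrXr; apply: ler_weXn2l; first exact: ltW.
  rewrite /c big_split /= sum1_card card_ord -big_distrr /= -mulnSr leq_mul2l.
  by rewrite (sum_expn2 (ltnW (ltn_ord i))) orbT.
(* At the index of the largest term this reads M^Q <= M^(k 2^j0) with M > 1, impossible for Q > k
   2^k. *)
have := key j0; rewrite -/M ler_eXn2l // leqNgt => /negP; apply.
apply: leq_ltn_trans ltQ; rewrite leq_mul2l leq_exp2l // (ltnW (ltn_ord j0)) orbT //.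
Qed.

(** The same descent as for valuation rings. For a pair x, y with a large quotient, the place and
    the direction (x/y or y/x) are chosen to maximise the absolute value; then one passes to a class
    comparable at that place. *)
Lemma bounded_quotients (i0 : I) t k (R : F) (W : {fset L}) :
    0 \notin W -> (0 < t)%N ->
    (forall Z : {fset L}, Z `<=` W -> dissociated Z -> (#|` Z| <= t)%N) ->
  (exists W' : {fset L}, [/\ W' `<=` W, (#|` W| <= t ^ k * #|` W'|)%N
     & forall x y i, x \in W' -> y \in W' -> v i (x / y) <= R])
  \/ exists s g, quotients W k g /\ place_chain R k s g.
Proof.
elim: k W => [|k IH] W W0 t0 bound.
  by right; exists (fun=> i0), (fun=> 0); split=> //; split=> // i' j'; rewrite ltn0 andbF.
have [W1|] := pselect (forall x y i, x \in W -> y \in W -> v i (x / y) <= R).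
  left; exists W; split=> //; by rewrite leq_pmull // expn_gt0 t0.
move=> /existsNP[x /existsNP[y /existsNP[i nle]]].
have [[Wx Wy] /negP] : (x \in W /\ y \in W) /\ ~ v i (x / y) <= R.
  by split; [split; apply: contrapT => h; apply: nle|move=> h; apply: nle].
rewrite -ltNge => {nle} ltR.
have nz z : z \in W -> z != 0 by move=> Wz; apply: contraNneq W0 => <-.
pose quo (b : bool) := if b then x / y else y / x.
have [[j b] _ maxjb] := @Order.TotalTheory.arg_maxP _ _ (I * bool)%type (i, true) predT
  (fun p => v p.1 (quo p.2)) isT.
have ltRj : R < v j (quo b) by apply: lt_le_trans (maxjb (i, true) isT).
have max1 p : v p (quo b) <= v j (quo b) by apply: (maxjb (p, b) isT).
have max2 p : v p (quo b)^-1 <= v j (quo b).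
  have -> : (quo b)^-1 = quo (~~ b) by rewrite /quo; case: (b); rewrite /= invf_div.
  exact: (maxjb (p, ~~ b) isT).
have [||Z ZW nZ|W1 [W1W leW sameW]] := @large_class L W (comparable2 (v j)) t.
- by move=> z; rewrite /comparable2 eqxx.
- by move=> z w; rewrite /comparable2 [z == w]eq_sym andbC.
- apply: bound => //; apply: (lacunary_dissociated (av j)) => //.
  by apply: contra W0; exact: (fsubsetP ZW).
have W10 : 0 \notin W1 by apply: contra W0; exact: (fsubsetP W1W).
have le4 z w : z \in W1 -> w \in W1 -> v j (z / w) <= 4.
  move=> Wz Ww; have [u [Wu]] := sameW _ _ Wz Ww.
  have pos a : a \in W -> 0 < v j a by move/nz/(absval_gt0 (av j)).
  have le2 a : a \in W -> comparable2 (v j) u a -> v j u <= 2 * v j a /\ v j a <= 2 * v j u.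
    move=> Wa /orP[/eqP->|/andP[/ltW ? /ltW ?] //].
    by have := pos _ Wa => h; split; lra.
  move=> /(le2 _ (fsubsetP W1W _ Wz))[_ h1] /(le2 _ (fsubsetP W1W _ Ww))[h2 _].
  rewrite (absvalM (av j)) (absvalV (av j)) ler_pdivrMr ?pos ?(fsubsetP W1W) //; lra.
have [|//|Z ZW1|[W2 [W2W1 leW1 bW2]]|[s [g [qg [c1 c2 c3 c4]]]]] := IH W1 => //.
- by apply: bound; apply: fsubset_trans W1W.
- left; exists W2; split=> //; first exact: fsubset_trans W1W.
  by apply: leq_trans leW _; rewrite expnS -mulnA leq_mul2l leW1 orbT.
right; exists (fun n => if n is m.+1 then s m else j),
  (fun n => if n is m.+1 then g m else quo b); split.
  case=> [_|m /qg[z [w [Pz Pw ->]]]].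
    by rewrite /quo; case: (b); [exists x, y|exists y, x].
  by exists z, w; rewrite !(fsubsetP W1W).
split.
- by case=> [|m] // /c1.
- by case=> [|m] // /c2.
- by case=> [|m] // /c3.
case=> [|m] [|m'] //; last exact: c4.
move=> /qg[z [w [Wz Ww ->]]]; rewrite invf_div.
by split; apply: le4.
Qed.

End Places.

(** * Congruences modulo 2 in a group of finite rank *)

Lemma dvdz2_sub_odd (n : int) : (2 %| n - Posz (odd `|n|%N))%Z.
Proof.
have H (o : bool) (h m : nat) : (o + h.*2)%N = m ->
    Posz m - Posz o = Posz h * 2 /\ - Posz m - Posz o = (- Posz o - Posz h) * 2 by lia.
apply/dvdzP; case: n => m.
  by exists (Posz m./2); have [] := H _ _ _ (odd_double_half m).
exists (- Posz (odd m.+1) - Posz m.+1./2).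
by rewrite NegzE abszN absz_nat; have [] := H _ _ _ (odd_double_half m.+1).
Qed.

(** Clear the denominators of a rational relation, then halve all coefficients as long as they are
    even; the sum of their absolute values decreases. *)
Lemma odd_relation (E : vectType rat) k (e : k.-tuple E) : ~~ free e ->
  exists n : 'I_k -> int, \sum_(i < k) e`_i *~ n i = 0 /\ exists i, odd `|n i|%N.
Proof.
move=> nfree.
have [c c0 [i0 ci0]] : exists2 c : 'I_k -> rat, \sum_(i < k) c i *: e`_i = 0 & exists i, c i != 0.
  apply: contrapT => h; case/negP: nfree; apply/freeP => c c0 i.
  by apply/eqP/negPn/negP => ci; apply: h; exists c => //; exists i.
have [n n0 [i ni]] : exists2 n : 'I_k -> int, \sum_(i < k) e`_i *~ n i = 0 & exists i, n i != 0.
  exists (fun i => numq (c i) * \prod_(j | j != i) denq (c j)); last first.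
    exists i0; rewrite mulf_neq0 ?numq_eq0 //.
    by apply/prodf_neq0 => j _; exact: denq_neq0.
  have D0 : (\prod_j (denq (c j))%:~R) *: \sum_(i < k) c i *: e`_i = 0 by rewrite c0 scaler0.
  apply: etrans D0; rewrite scaler_sumr; apply: eq_bigr => i _.
  rewrite -scaler_int scalerA; congr (_ *: _); rewrite [X in _ = X * _](bigD1 i) //=.
  by rewrite rmorphM /= rmorph_prod /= numqE [RHS]mulrAC [c i * _]mulrC.
have [N] := ubnP (\sum_i `|n i|)%N; elim: N n n0 i ni => // N IH n n0 i ni leN.
have [[j oj]|noodd] := pselect (exists i, odd `|n i|%N); first by exists n; split=> //; exists j.
pose m j := (n j %/ 2)%Z.
have nm j : n j = m j * 2.
  rewrite [LHS](divz_eq _ 2) (_ : (n j %% 2)%Z = 0) ?addr0 //.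
  apply/dvdz_mod0P; rewrite dvdzE /= dvdn2; apply/negP => oj.
  by apply: noodd; exists j.
apply: (IH m _ i).
- have : (\sum_(i < k) e`_i *~ m i) *~ 2 = 0.
    by apply: etrans n0; rewrite mulrz_suml; apply: eq_bigr => j _; rewrite -mulrzA nm.
  by rewrite -scaler_int => /eqP; rewrite scaler_eq0 => /orP[|/eqP].
- by apply: contra_neq ni => mi; rewrite nm mi.
have e2 : (\sum_j `|n j| = 2 * \sum_j `|m j|)%N.
  by rewrite big_distrr /=; apply: eq_bigr => j _; rewrite nm abszM mulnC.
have : (0 < `|m i|)%N by rewrite absz_gt0; apply: contra_neq ni => mi; rewrite nm mi.
have : (`|m i| <= \sum_j `|m j|)%N by rewrite (bigD1 i) //= leq_addr.
by move: leN; rewrite e2; lia.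
Qed.

Section Halving.

Variables (E : vectType rat) (d : nat) (V : {vspace E}) (Lam : E -> Prop).
Hypothesis dimV : (\dim V <= d)%N.
Hypothesis LamV : forall x, Lam x -> x \in V.
Hypothesis Lam0 : Lam 0.
Hypothesis LamB : forall x y, Lam x -> Lam y -> Lam (x - y).

Let LamN x : Lam x -> Lam (- x). Proof. by rewrite -sub0r; apply: LamB. Qed.
Let LamD x y : Lam x -> Lam y -> Lam (x + y).
Proof. by move=> hx hy; rewrite -[y]opprK; apply: (LamB) => //; apply: LamN. Qed.
Let LamMn x n : Lam x -> Lam (x *+ n).
Proof. by move=> hx; elim: n => // n IH; rewrite mulrS; apply: LamD. Qed.
Let LamMz x n : Lam x -> Lam (x *~ n).
Proof. by move=> hx; case: n => n; [exact: LamMn|rewrite NegzE mulrNz; exact/LamN/LamMn]. Qed.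
Let Lam_sum (I : Type) (r : seq I) (P : pred I) (F : I -> E) :
  (forall i, P i -> Lam (F i)) -> Lam (\sum_(i <- r | P i) F i).
Proof. exact: (big_ind Lam). Qed.

Definition congr2 x y := exists2 z, Lam z & x - y = z *+ 2.

Let congr2_sym x y : congr2 x y -> congr2 y x.
Proof. by move=> [z Lz e]; exists (- z); [exact: LamN|rewrite mulNrn -e opprB]. Qed.

Let congr2_trans y x z : congr2 x y -> congr2 y z -> congr2 x z.
Proof.
move=> [u Lu eu] [w Lw ew]; exists (u + w); first exact: LamD.
by rewrite mulrnDl -eu -ew addrA subrK.
Qed.

Let congr2_refl x : congr2 x x.
Proof. by exists 0; rewrite ?subrr ?mul0rn. Qed.

Let bsum (e : seq E) (b : nat -> bool) := \sum_(i < size e) e`_i *+ b i.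

(** A basis, over the field with two elements, of the span of [U] in Lam / 2 Lam; booleans are the
    coefficients. *)
Lemma congr2_basis (U : seq E) : (forall u, u \in U -> Lam u) ->
  exists e : seq E, [/\ forall x, x \in e -> Lam x,
    forall b, congr2 (bsum e b) 0 -> forall i, (i < size e)%N -> ~~ b i
  & forall u, u \in U -> exists b, congr2 u (bsum e b)].
Proof.
elim: U => [|u U IH] LU.
  by exists [::]; split=> // b _ i; rewrite ltn0.
have [|e [Le ind span]] := IH; first by move=> x xU; apply: LU; rewrite inE xU orbT.
have Lu : Lam u by apply: LU; rewrite inE eqxx.
have [[b ub]|nu] := pselect (exists b, congr2 u (bsum e b)).
  exists e; split=> // x; rewrite inE => /predU1P[->|]; [by exists b|exact: span].
have bsum_cons c : bsum (u :: e) c = u *+ c 0%N + bsum e (fun i => c i.+1).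
  by rewrite /bsum /= big_ord_recl.
exists (u :: e); split.
- by move=> x; rewrite inE => /predU1P[->|]; [|exact: Le].
- move=> b; rewrite bsum_cons; case b0: (b 0%N) => /=.
    rewrite mulr1n => h; case: nu; exists (fun i => b i.+1).
    have [z Lz] := h; rewrite subr0 => ez.
    (* Signs are immaterial modulo 2: from u + s = 2z follows u - s = 2(z - s). *)
    exists (z - bsum e (fun i => b i.+1)).
      apply: (LamB) => //; apply: Lam_sum => i _.
      by apply: LamMn; apply: Le; apply: mem_nth.
    by rewrite mulrnBl -ez mulr2n opprD addrA addrK.
  rewrite mulr0n add0r => /ind h [|i] //=; first by rewrite b0.
  by rewrite ltnS; exact: h.
move=> x; rewrite inE => /predU1P[->|/span[b xb]].
  exists (fun i => i == 0%N); rewrite bsum_cons /= mulr1n /bsum big1 ?addr0 //.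
exists (fun i => if i is j.+1 then b j else false).
by rewrite bsum_cons /= mulr0n add0r.
Qed.

(** Lam / 2 Lam has dimension at most [d]: by [odd_relation], a rational dependence among the lifts
    of a basis would reduce to a nontrivial one modulo 2. Incongruent elements have distinct
    coordinates. *)
Lemma card_incongruent (Z : {fset E}) :
  {in Z &, forall x y, Lam (x - y)} ->
  {in Z &, forall x y, congr2 x y -> x = y} -> (#|` Z| <= 2 ^ d)%N.
Proof.
move=> LZ nc; have [->|/fset0Pn[z0 Zz0]] := eqVneq Z fset0; first by rewrite cardfs0.
have [|e [Le ind span]] := @congr2_basis [seq z - z0 | z <- enum_fset Z].
  by move=> _ /mapP[z Zz ->]; apply: LZ.
have sz : (size e <= d)%N.
  have free_e : free e.
    apply/negPn/negP => /(@odd_relation _ _ (in_tuple e))[n [n0 [i oi]]].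
    pose b j := if insub j is Some j' then odd `|n j'|%N else false.
    have bE (j : 'I_(size e)) : b j = odd `|n j|%N.
      by rewrite /b valK.
    have /ind/(_ i (ltn_ord i)) : congr2 (bsum e b) 0; last by rewrite bE oi.
    exists (- \sum_(j < size e) e`_j *~ ((n j - Posz (odd `|n j|%N)) %/ 2)%Z).
      apply: LamN; apply: Lam_sum => j _; apply: LamMz; apply: Le; exact: mem_nth.
    rewrite subr0 mulNrn; apply/eqP; rewrite -addr_eq0 -sumrMnl -big_split /=.
    apply/eqP; apply: etrans n0; apply: eq_bigr => j _; rewrite bE !pmulrn -mulrzA -mulrzDr; congr (_ *~ _).
    have : (2 %| (n j - Posz (odd `|n j|%N)))%Z.
      exact: dvdz2_sub_odd.
    by move/divzK => ->; rewrite addrC subrK.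
  apply: leq_trans dimV; move: free_e; rewrite /free => /eqP <-.
  apply: dimvS; apply/span_subvP => x /Le; exact: LamV.
have [f fP] : exists f : E -> {ffun 'I_(size e) -> bool}, forall z, z \in Z ->
    congr2 (z - z0) (\sum_(i < size e) e`_i *+ f z i).
  have h z : exists g : {ffun 'I_(size e) -> bool}, z \in Z ->
      congr2 (z - z0) (\sum_(i < size e) e`_i *+ g i).
    have [Zz|] := boolP (z \in Z); last by exists [ffun => false].
    have [|b zb] := span (z - z0); first by apply/mapP; exists z.
    exists [ffun i => b (val i)] => _.
    by move: zb; rewrite /bsum; under eq_bigr do rewrite -[b _](ffunE (fun i => b (val i))).
  by exists (fun z => projT1 (cid (h z))) => z; apply: (projT2 (cid (h z))).
have f_inj : {in Z &, injective f}.
  move=> x y Zx Zy exy; apply: nc => //.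
  have [z Lz ez] : congr2 (x - z0) (y - z0).
    by apply: congr2_trans (fP _ Zx) _; rewrite exy; apply/congr2_sym/fP.
  by exists z => //; rewrite -ez opprB addrA subrK.
have <- : #|` [fset f x | x in Z]| = #|` Z| by apply: card_in_imfset.
apply: (@leq_trans (2 ^ size e)); last by rewrite leq_exp2l.
have <- : #|{: {ffun 'I_(size e) -> bool}}| = (2 ^ size e)%N.
  by rewrite card_ffun card_bool card_ord.
by rewrite cardE; apply: uniq_leq_size (fset_uniq _) _ => g _; rewrite mem_enum.
Qed.

(** Some class modulo 2 Lam keeps at least |X| / 2^d elements. Its map x -> (x - x0)/2 again has
    differences in [Lam], so the step can be repeated [s] times. *)
Lemma large_set_divisible s (X : {fset E}) :
    {in X &, forall x y, Lam (x - y)} -> (2 ^ (d * s) < #|` X|)%N ->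
  exists x y z, [/\ x \in X, y \in X, x != y, Lam z & x - y = z *+ 2 ^ s].
Proof.
elim: s X => [|s IH] X LX ltX.
  have /fset0Pn[x Xx] : X != fset0 by rewrite -cardfs_gt0 (leq_trans _ ltX).
  have /fset0Pn[y] : X `\ x != fset0.
    by rewrite -cardfs_gt0; move: ltX; rewrite (cardfsD1 x) Xx muln0.
  rewrite !inE => /andP[yx Xy]; exists y, x, (y - x); split=> //; first exact: LX.
have [||Z ZX nZ|X1 [X1X leX same]] := @large_class E X (fun x y => `[< congr2 x y >]) (2 ^ d).
- by move=> x; apply/asboolP.
- by move=> x y; apply/asboolP/asboolP => /congr2_sym.
- apply: card_incongruent.
    by move=> x y Zx Zy; apply: LX; apply: (fsubsetP ZX).
  by move=> x y Zx Zy c; apply: nZ => //; apply/asboolP.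
have lt1 : (2 ^ (d * s) < #|` X1|)%N.
  have := leq_trans ltX leX; rewrite mulnS expnD ltn_pmul2l ?expn_gt0 //.
have /fset0Pn[x0 X1x0] : X1 != fset0 by rewrite -cardfs_gt0 (leq_trans _ lt1).
have c0 x : x \in X1 -> congr2 x x0.
  move=> Xx; have [y [_ /asboolP cx /asboolP c0]] := same _ _ Xx X1x0.
  by apply: congr2_trans c0; apply: congr2_sym.
pose h x := 2^-1 *: (x - x0).
have hK x : h x *+ 2 = x - x0.
  by rewrite -scaler_nat /h scalerA mulfV ?scale1r.
have h_inj : injective h.
  by move=> x y e; apply: (addIr (- x0)); rewrite -!hK e.
have div2_inj (x y : E) : x *+ 2 = y *+ 2 -> x = y.
  by rewrite -!scaler_nat => /(scalerI _); apply.
have Lh : {in [fset h x | x in X1] &, forall x y, Lam (x - y)}.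
  move=> _ _ /imfsetP[x /= Xx ->] /imfsetP[y /= Xy ->].
  have [z Lz ez] : congr2 x y.
    by apply: congr2_trans (c0 _ Xx) _; apply/congr2_sym/c0.
  rewrite (_ : h x - h y = z) //; apply: div2_inj.
  by rewrite -ez mulrnBl !hK opprB addrA subrK.
have [|_ [_ [z [/imfsetP[x /= Xx ->] /imfsetP[y /= Xy ->] hxy Lz ez]]]] := IH _ Lh.
  by rewrite card_imfset.
exists x, y, z; split; rewrite ?(fsubsetP X1X) //.
  by apply: contra_neq hxy => ->.
by rewrite expnS mulnC mulrnA -ez mulrnBl !hK opprB addrA subrK.
Qed.

End Halving.

(** * Counting elements with integral and bounded quotients *)

Lemma free_generators (E : vectType rat) (X : seq E) :
  exists Y, [/\ {subset Y <= X}, free Y & <<Y>>%VS = <<X>>%VS].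
Proof.
elim: X => [|x X [Y [YX fY spanY]]]; first by exists [::]; split; rewrite ?nil_free.
have [xY|xY] := boolP (x \in <<Y>>%VS).
  exists Y; split=> //; first by move=> y /YX yX; rewrite inE yX orbT.
  by rewrite span_cons -spanY; apply/esym/addv_idPr; rewrite -memvE.
exists (x :: Y); split; last by rewrite !span_cons spanY.
  by move=> y; rewrite !inE => /orP[->//|/YX ->]; rewrite orbT.
by rewrite free_cons xY.
Qed.

Lemma dim_differences (E : vectType rat) (W : {fset E}) d w0 : w0 \in W ->
    (forall g, differences W d.+1 g -> ~ addindep d.+1 g) ->
  (\dim <<[seq (w - w0)%R | w <- enum_fset W]>> <= d)%N.
Proof.
move=> Ww0 dep; have [Y [YX fY <-]] := free_generators [seq w - w0 | w <- enum_fset W].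
move: (fY); rewrite /free => /eqP ->; rewrite leqNgt; apply/negP => ltd.
apply: (dep (fun i => Y`_i)).
  move=> i id; have /YX/mapP[w Ww ->] : Y`_i \in Y by rewrite mem_nth // (leq_trans id).
  by exists w, w0.
move=> n; have : free (take d.+1 Y) by move: fY; rewrite -{1}(cat_take_drop d.+1 Y) => /catl_free.
have sz : size (take d.+1 Y) = d.+1 by rewrite size_takel.
move=> /(@freeP _ _ _ (Tuple (introT eqP sz))) fr n0 i id; apply/eqP; rewrite -(intr_eq0 rat); apply/eqP.
apply: (fr (fun j => (n j)%:~R) _ (Ordinal id)).
by apply: etrans n0; apply: eq_bigr => j _; rewrite /= nth_take // scaler_int.
Qed.

Section FewUnits.

Variables (L : fieldExtType rat) (F : realFieldType) (I : finType) (v : I -> L -> F).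
Hypothesis av : forall i, absval (v i).
Hypothesis v2 : forall i, v i 2 = 2.
Hypothesis product_formula : forall x, x != 0 -> integralOver (intr : int -> L) x ->
  exists i, 1 <= v i x.

(** Otherwise x - y = 2^s z with z/y integral and nonzero. At a place where |z/y| >= 1 one gets 2^s
    <= |x/y - 1| <= R + 1 <= 2R. *)
Lemma few_bounded_units d s (R : F) (W : {fset L}) :
    0 \notin W ->
    {in W &, forall x y, integralOver (intr : int -> L) (x / y)} ->
    (forall x y i, x \in W -> y \in W -> v i (x / y) <= R) ->
    (forall g, differences W d.+1 g -> ~ addindep d.+1 g) ->
    2 * R < 2 ^+ s ->
  (#|` W| <= 2 ^ (d * s))%N.
Proof.
move=> W0 intW bW dep ltR; have [->|/fset0Pn[w0 Ww0]] := eqVneq W fset0.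
  by rewrite cardfs0.
have nz w : w \in W -> w != 0 by move=> Ww; apply: contraNneq W0 => <-.
set V := <<[seq w - w0 | w <- enum_fset W]>>%VS.
(* Integrality against every w is asked since y is not known yet. This group contains all
   differences of [W], its quotients being integral. *)
pose Lam z := z \in V /\ forall w, w \in W -> integralOver (intr : int -> L) (z / w).
rewrite leqNgt; apply/negP => ltW.
have [|||||x [y [z [Wx Wy xy [_ iz] exy]]]] := @large_set_divisible L d V Lam _ _ _ _ s W _ ltW.
- exact: dim_differences.
- by move=> z [].
- by split=> [|w _]; rewrite ?mem0v // mul0r; exact: integral0.
- move=> a b [Va ia] [Vb ib]; split; first by rewrite memvB.
  by move=> w Ww; rewrite mulrBl; apply: integral_sub; [apply: ia|apply: ib].
- move=> a b Wa Wb; split.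
    rewrite (_ : a - b = (a - w0) - (b - w0)); last by rewrite opprB addrA subrK.
    by rewrite memvB //; apply: memv_span; apply: map_f.
  by move=> w Ww; rewrite mulrBl; apply: integral_sub; apply: intW.
have y0 := nz _ Wy.
have z0 : z != 0.
  by apply: contra_neq xy => z0; apply/eqP; rewrite -subr_eq0 exy z0 mul0rn.
have [i] : exists i, 1 <= v i (z / y).
  by apply: product_formula; [rewrite mulf_neq0 ?invr_eq0|apply: iz].
have R1 : 1 <= R.
  by have := bW _ _ i Wy Wy; rewrite mulfV // (absval1 (av i)).
have : v i (2 ^+ s * (z / y)) <= 2 * R.
  have -> : 2 ^+ s * (z / y) = x / y - 1.
    rewrite mulrA -natrX mulr_natl -exy mulrBl mulfV //.
  apply: le_trans (absvalD (av i) _ _) _.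
  have -> : v i (- 1) = 1 by rewrite -[-1]mulr1 -{1}(expr1 (-1)) (absval_sign (av i) true) (absval1 (av i)).
  have := bW _ _ i Wx Wy; lra.
rewrite (absvalM (av i)) (absvalX (av i)) v2 => h1 h2.
have : 2 ^+ s <= 2 ^+ s * v i (z / y) by rewrite ler_peMr // exprn_ge0.
by lra.
Qed.

End FewUnits.

(** * Number fields and their embeddings *)

Section RatEmbedding.

Variable K : fieldType.
Hypothesis hK : has_pchar0 K.

Let int0 (n : int) : (n%:~R == 0 :> K) = (n == 0).
Proof.
have nat0 m : (m%:R == 0 :> K) = (m == 0%N) by rewrite (proj1 (pcharf0P K) hK).
by case: n => n; [exact: nat0|rewrite NegzE rmorphN !oppr_eq0; exact: nat0].
Qed.

Let den0 (x : rat) : (denq x)%:~R != 0 :> K. Proof. by rewrite int0 denq_neq0. Qed.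

Let ratK (x : rat) : K := (numq x)%:~R / (denq x)%:~R.

Let ratKE (a b : int) : b != 0 -> ratK (a%:~R / b%:~R) = a%:~R / b%:~R.
Proof.
move=> b0; set x := _ / _; have b0K : b%:~R != 0 :> K by rewrite int0.
apply/eqP; rewrite /ratK eqr_div // -!rmorphM /= -subr_eq0 -rmorphB /= int0 subr_eq0.
rewrite -(eqr_int rat) !rmorphM /= numqE /x.
by apply/eqP; rewrite mulrAC divfK ?intr_eq0.
Qed.

Lemma rat_embedding : exists f : {rmorphism rat -> K}, True.
Proof.
have add : zmod_morphism ratK.
  move=> x y; have -> : x - y = (numq x * denq y - numq y * denq x)%:~R / (denq x * denq y)%:~R.
    rewrite -{1}(divq_num_den x) -{1}(divq_num_den y).
    rewrite rmorphB !rmorphM /=; field.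
    by rewrite !intr_eq0 !denq_neq0.
  rewrite ratKE ?mulf_neq0 ?denq_neq0 // /ratK rmorphB !rmorphM /=; field.
  by rewrite !den0.
have mul : monoid_morphism ratK.
  split=> [|x y]; first by rewrite /ratK divr1.
  have -> : x * y = (numq x * numq y)%:~R / (denq x * denq y)%:~R.
    rewrite -{1}(divq_num_den x) -{1}(divq_num_den y) !rmorphM /=; field.
    by rewrite !intr_eq0 !denq_neq0.
  rewrite ratKE ?mulf_neq0 ?denq_neq0 // /ratK !rmorphM /=; field.
  by rewrite !den0.
pose A := GRing.isZmodMorphism.Build _ _ ratK add.
pose M := GRing.isMonoidMorphism.Build _ _ ratK mul.
by exists (HB.pack_for {rmorphism rat -> K} ratK A M).
Qed.

End RatEmbedding.

(** The field generated by the roots of [q] in [algC]; [kappa] will supply the archimedean absolute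
    values. *)
Lemma splitting_number_field (q : {poly int}) : q \is monic ->
  exists (L : splittingFieldType rat) (kappa : {rmorphism L -> algC}) (r : seq L),
    map_poly intr q = \prod_(z <- r) ('X - z%:P).
Proof.
move=> mq; have [rs rsE] := closed_field_poly_normal (map_poly intr q : {poly algC}).
have [L0 [kappa [r kr gen]]] := num_field_exists rs.
have qE : map_poly intr q = \prod_(z <- r) ('X - z%:P) :> {poly L0}.
  apply: (map_poly_inj kappa); rewrite -map_poly_comp (eq_map_poly (g := intr)); last first.
    by move=> n; rewrite /= rmorph_int.
  rewrite rsE lead_coef_map_eq ?(monicP mq) ?rmorph1 ?oner_eq0 // scale1r -kr.
  rewrite big_map rmorph_prod /=; apply: eq_bigr => z _.
  by rewrite rmorphB /= map_polyX map_polyC.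
have split : SplittingField.axiom L0.
  exists (map_poly intr q).
    by apply/polyOverP => i; rewrite coef_map rpred_int.
  by exists r; rewrite ?qE ?eqpxx.
pose M := FieldExt_isSplittingField.Build _ L0 split.
pose L : splittingFieldType rat := HB.pack L0 M.
by exists L, kappa, r.
Qed.

(** With a primitive element th of minimal polynomial f, and a root t of f in [K], the map p(th) ->
    p(t) is well defined. As [kappa] is injective, f can be computed in [algC]. *)
Lemma number_field_embedding (K : closedFieldType) (L : fieldExtType rat)
    (kappa : {rmorphism L -> algC}) :
  has_pchar0 K -> exists iota : {rmorphism L -> K}, True.
Proof.
move=> hK; have [rK _] := rat_embedding hK.
have pcharL : [pchar L] =i pred0 by move=> p; rewrite pchar_lalg pchar_num.
pose th := separable_generator 1%AS {:L}%AS.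
have gen x : exists p : {poly rat}, x = (map_poly (in_alg L) p).[th].
  have xth : x \in <<1; th>>%VS.
    rewrite -(eq_adjoin_separable_generator _ (sub1v _)) ?memvf //.
    by apply/separableP=> y _; exact: pcharf0_separable.
  have /polyOver1P[p pE] := Fadjoin_polyOver 1%AS th x.
  by exists p; rewrite -pE Fadjoin_poly_eq.
have [f [_ mf] dvf] := minCpolyP (kappa th).
have ker p : ((map_poly (in_alg L) p).[th] == 0) = (f %| p).
  rewrite -dvf -(fmorph_eq0 kappa) -horner_map -map_poly_comp rootE.
  congr (_.[_] == 0); apply: eq_map_poly => a /=.
  by rewrite alg_num_field fmorph_rat.
have szf : (1 < size f)%N.
  rewrite ltn_neqAle eq_sym; apply/andP; split; last by rewrite size_poly_gt0 monic_neq0.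
  apply: contraTneq (dvdpp f) => szf; rewrite -ker.
  have /size_poly1P[c c0 ->] : size f == 1%N by rewrite szf.
  by rewrite map_polyC hornerC fmorph_eq0.
have [tK tKP] : exists t : K, root (map_poly rK f) t.
  by apply/closed_rootP; rewrite size_map_poly neq_ltn szf orbT.
have kerK p : (map_poly (in_alg L) p).[th] = 0 -> (map_poly rK p).[tK] = 0.
  move/eqP; rewrite ker => /dvdpP[g ->].
  by rewrite rmorphM hornerM (rootP tKP) mulr0.
have [h hE] : exists h : L -> K, forall p, h (map_poly (in_alg L) p).[th] = (map_poly rK p).[tK].
  have [P PE] : exists P : L -> {poly rat}, forall x, x = (map_poly (in_alg L) (P x)).[th].
    by exists (fun x => projT1 (sig_eqW (gen x))) => x; apply: (projT2 (sig_eqW (gen x))).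
  exists (fun x => (map_poly rK (P x)).[tK]) => p; apply/eqP; rewrite -subr_eq0 -hornerN -hornerD.
  rewrite -rmorphB; apply/eqP/kerK; rewrite rmorphB hornerD hornerN -PE subrr //.
have add : zmod_morphism h.
  move=> x y; have [[p ->] [p' ->]] := (gen x, gen y).
  by rewrite -hornerN -hornerD -rmorphB !hE rmorphB hornerD hornerN.
have mul : monoid_morphism h.
  split=> [|x y].
    by have := hE 1; rewrite !rmorph1 !hornerC.
  have [[p ->] [p' ->]] := (gen x, gen y).
  by rewrite -hornerM -rmorphM !hE rmorphM hornerM.
pose A := GRing.isZmodMorphism.Build _ _ h add.
pose M := GRing.isMonoidMorphism.Build _ _ h mul.
by exists (HB.pack_for {rmorphism L -> K} h A M).
Qed.

(** * Archimedean places of a Galois number field *)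

Section GaloisPlaces.

Variables (L : splittingFieldType rat) (kappa : {rmorphism L -> algC}).

(** As [L] is Galois over the rationals, composing one embedding with all automorphisms gives every
    archimedean place. Values are taken in [algR], whose order is total, unlike that of [algC]. *)
Definition galois_place (g : gal_of {:L}) (x : L) : algR :=
  in_algR (normr_real (kappa (g x))).

Lemma galois_place_absval g : absval (galois_place g).
Proof.
split=> [x|x|x y|x y].
- exact: normr_ge0.
- by rewrite -(inj_eq val_inj) /= normr_eq0 !fmorph_eq0.
- by apply: val_inj; rewrite /= !rmorphM normrM.
- suff : `|kappa (g (x + y))| <= `|kappa (g x)| + `|kappa (g y)| by [].
  by rewrite !rmorphD; exact: ler_normD.
Qed.

Lemma galois_place_nat g n : galois_place g n%:R = n%:R.
Proof.
by apply: val_inj; rewrite /= !rmorph_nat normr_nat.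
Qed.

(** The norm is the product of the conjugates; for a nonzero algebraic integer it is a nonzero
    rational integer, so not all conjugates have modulus below 1. *)
Lemma galois_product_formula x : x != 0 -> integralOver (intr : int -> L) x ->
  exists g, 1 <= galois_place g x.
Proof.
move=> x0 [q mq qx].
have gal : galois 1%AS {:L}%AS.
  apply/and3P; split; [exact: sub1v| |exact: normalFieldf].
  apply/separableP=> y _; apply: pcharf0_separable => p.
  by rewrite pchar_lalg pchar_num.
have Nx := mem_galNorm gal (memvf x).
pose z := kappa (galNorm 1%AS {:L}%AS x).
have z0 : z != 0 by rewrite fmorph_eq0 galNorm_eq0.
have zE : z = \prod_(g in ('Gal({:L} / 1%AS))%g) kappa (g x) by rewrite /z rmorph_prod.
have int (g : gal_of {:L}) : kappa (g x) \in Aint.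
  apply: (@root_monic_Aint (map_poly intr q)).
  - have := qx; rewrite -(fmorph_root g) -(fmorph_root kappa) -!map_poly_comp.
    by rewrite (eq_map_poly (g := intr)) // => n; rewrite /= !rmorph_int.
  - exact: monic_map.
  - by apply/polyOverP => i; rewrite coef_map rpred_int.
have zint : z \in Num.int.
  apply: Cint_rat_Aint; last by rewrite zE rpred_prod.
  have /vlineP[a za] := Nx.
  by rewrite /z za alg_num_field fmorph_rat Crat_rat.
have z1 : 1 <= `|z| by rewrite norm_intr_ge1.
apply: contrapT => small.
have lt1 (g : gal_of {:L}) : `|kappa (g x)| < 1.
  rewrite real_ltNge ?normr_real ?real1 //; apply/negP => ge1.
  by apply: small; exists g.
suff : `|z| < 1 by rewrite real_ltNge ?normr_real ?real1 // z1.
pose e := 1%g : gal_of {:L}; rewrite zE normr_prod (bigD1 e (group1 _)) /=.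
apply: le_lt_trans (lt1 e); rewrite ler_piMr // prodr_ile1 // => g _.
by rewrite normr_ge0 ltW ?lt1.
Qed.

End GaloisPlaces.

(** * Transfer to a number field *)

Lemma dissociated_imfset (U V : zmodType) (f : {additive U -> V}) (Z : {fset U}) :
  injective f -> dissociated Z -> dissociated [fset f x | x in Z].
Proof.
move=> f_inj dZ.
have pre (B : {fset V}) : B `<=` [fset f x | x in Z] ->
    exists2 B' : {fset U}, B' `<=` Z & B = [fset f x | x in B'].
  move=> BZ; exists [fset x in Z | f x \in B].
    by apply/fsubsetP=> x; rewrite !inE => /andP[].
  apply/fsetP=> y; apply/idP/imfsetP => [By|[x]]; last first.
    by rewrite !inE /= => /andP[_ fB] ->.
  have /imfsetP[x /= Zx yx] := fsubsetP BZ _ By.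
  by exists x => //; rewrite !inE /= Zx -yx.
have sumE (B : {fset U}) : \sum_(y <- [fset f x | x in B]) y = f (\sum_(x <- B) x).
  by rewrite big_imfset /= ?raddf_sum // => x y _ _ /f_inj.
move=> B C /pre[B' B'Z ->] /pre[C' C'Z ->].
by rewrite !sumE => /f_inj /(dZ _ _ B'Z C'Z) ->.
Qed.

Lemma integral_fmorph (L K : fieldType) (f : {rmorphism L -> K}) x :
  integralOver (intr : int -> K) (f x) -> integralOver (intr : int -> L) x.
Proof.
move=> [p mp px]; exists p => //; rewrite -(fmorph_root f) -map_poly_comp.
have -> : map_poly (f \o intr) p = map_poly intr p :> {poly K}; last by [].
by apply: eq_map_poly => n; rewrite /= rmorph_int.
Qed.

(** Fix a in [P]. All x/a are roots of one monic integer polynomial, a product of integral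
    equations, and its splitting field embeds into [K]. *)
Lemma number_field_model (K : closedFieldType) (P : {fset K}) :
    has_pchar0 K -> P != fset0 -> 0 \notin P ->
    {in P &, forall x y, integralOver (intr : int -> K) (x / y)} ->
  exists (L : splittingFieldType rat) (kappa : {rmorphism L -> algC})
    (iota : {rmorphism L -> K}) (a : K) (W : {fset L}),
    a != 0 /\ P = [fset a * iota w | w in W].
Proof.
move=> hK /fset0Pn[a Pa] P0 intP; have a0 : a != 0 by apply: contraNneq P0 => <-.
have [q mq qP] : exists2 q : {poly int}, q \is monic &
    forall x, x \in P -> root (map_poly intr q) (x / a).
  suff H (s : seq K) : {subset s <= P} -> exists2 q : {poly int}, q \is monic &
      forall x, x \in s -> root (map_poly intr q) (x / a) by exact: (H (enum_fset P)).
  elim: s => [|x s IH] sP; first by exists 1; rewrite ?monic1.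
  have [|q mq qs] := IH; first by move=> y ys; apply: sP; rewrite inE ys orbT.
  have [p mp px] := intP _ _ (sP x (mem_head _ _)) Pa.
  exists (p * q) => [|y]; first by rewrite monicMl.
  rewrite rmorphM rootM inE => /predU1P[->|/qs ->]; last by rewrite orbT.
  by rewrite px.
have [L [kappa [r rE]]] := splitting_number_field mq.
have [iota _] := number_field_embedding kappa hK.
exists L, kappa, iota, a, [fset w in r | a * iota w \in P]; split=> //.
apply/fsetP=> x; apply/idP/imfsetP => [Px|[w]]; last first.
  by rewrite !inE /= => /andP[_ Pw] ->.
have [w rw e] : exists2 w, w \in r & x / a = iota w.
  have := qP _ Px.
  have -> : map_poly intr q = \prod_(z <- map iota r) ('X - z%:P) :> {poly K}.
    have <- : map_poly iota (map_poly intr q) = map_poly intr q :> {poly K}.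
      by rewrite -map_poly_comp; apply: eq_map_poly => n; rewrite /= rmorph_int.
    rewrite rE rmorph_prod big_map; apply: eq_bigr => z _.
    by rewrite /= rmorphB /= map_polyX map_polyC.
  by rewrite root_prod_XsubC => /mapP[w rw e]; exists w.
have xE : x = a * iota w by rewrite -e mulrC divfK.
by exists w; rewrite // !inE /= rw -xE.
Qed.

(** Each of the two descents, along valuation rings and along archimedean places, costs a factor
    t^(d+1); what survives has at most 2^(d s) elements with R = 4^Q and s = 2Q + 2. *)
Lemma piece_bound (K : closedFieldType) (A : {fset K}) t d l q E Q :
    has_pchar0 K -> 0 \notin A -> (0 < t)%N -> (0 < q)%N ->
    (l * t.*2.+1 * q <= #|` A|)%N ->
    (#|` sumset A| <= 2 ^ t)%N -> (#|` prodset A| <= 2 ^ t)%N ->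
    (d.+1 * E <= l)%N -> (2 ^ t.*2 < E ^ d.+1)%N -> (d.+1 * 2 ^ d.+1 < Q)%N ->
  (q <= t ^ d.+1 * (t ^ d.+1 * 2 ^ (d * Q.+1.*2)))%N.
Proof.
move=> hK A0 t0 q0 leA leS leP dl tE dQ.
have [P [PA cP] [mdep adep bound]] := good_piece A0 q0 leA leS leP dl tE.
have P0 : 0 \notin P by apply: contra A0; apply: (fsubsetP PA).
have [[P1 [P1P leP1 intP1]]|[g qg]] := integral_quotients d.+1 P0 t0 bound; last first.
  by move/(mdep _ qg).
rewrite -cP; apply: (leq_trans leP1); rewrite leq_mul2l; apply/orP; right.
have [->|P1n] := eqVneq P1 fset0; first by rewrite cardfs0.
have P10 : 0 \notin P1 by apply: contra P0; apply: (fsubsetP P1P).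
have [L [kappa [iota [a [W [a0 P1E]]]]]] := number_field_model hK P1n P10 intP1.
have f_add : zmod_morphism (fun w => a * iota w).
  by move=> x y; rewrite rmorphB mulrBr.
(* Scaling by a keeps the map additive and cancels in quotients, so sums, differences and quotients
   all transfer. *)
pose f : {additive L -> K} := HB.pack (fun w => a * iota w)
  (GRing.isZmodMorphism.Build _ _ (fun w => a * iota w) f_add).
have f_inj : injective f by move=> x y /(mulfI a0) /fmorph_inj.
have fP w : w \in W -> f w \in P.
  by move=> Ww; apply: (fsubsetP P1P); rewrite P1E; apply/imfsetP; exists w.
have cW : #|` P1| = #|` W| by rewrite P1E; apply: card_imfset.
have W0 : 0 \notin W by apply/negP => /fP; rewrite raddf0 (negPf P0).
have fdiv x y : f x / f y = iota (x / y).
  by rewrite /= invfM mulrACA mulfV // mul1r fmorph_div.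
have boundW Z : Z `<=` W -> dissociated Z -> (#|` Z| <= t)%N.
  move=> ZW dZ; have <- : #|` [fset f w | w in Z]| = #|` Z| by apply: card_imfset.
  apply: bound; last exact: dissociated_imfset.
  by apply/fsubsetP=> _ /imfsetP[w /= Zw ->]; apply/fP/(fsubsetP ZW).
have mdepW g : quotients W d.+1 g -> ~ mulindep d.+1 g.
  move=> qg ig; apply: (mdep (iota \o g)).
    by move=> i /qg[x [y [Wx Wy gE]]]; exists (f x), (f y); rewrite !fP // fdiv /= gE.
  move=> n; rewrite (eq_bigr (fun i : 'I_d.+1 => iota (g i ^ n i))); last first.
    by move=> i _; rewrite /= fmorphXz.
  by rewrite -rmorph_prod => /eqP; rewrite fmorph_eq1 => /eqP; exact: ig.
have adepW g : differences W d.+1 g -> ~ addindep d.+1 g.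
  move=> dg ig; apply: (adep (f \o g)).
    by move=> i /dg[x [y [Wx Wy gE]]]; exists (f x), (f y); rewrite !fP // -raddfB /= gE.
  move=> n; rewrite (eq_bigr (fun i : 'I_d.+1 => f (g i *~ n i))); last first.
    by move=> i _; rewrite raddfMz.
  by rewrite -raddf_sum -[RHS](raddf0 f) => /f_inj; exact: ig.
have av g := @galois_place_absval L kappa g.
have [[W1 [W1W leW1 bW1]]|[s [g [qg ch]]]] :=
  @bounded_quotients _ _ _ _ av 1%g t d.+1 (4 ^+ Q) W W0 t0 boundW; last first.
  by case: (mdepW _ qg); exact: place_chain_mulindep dQ ch.
rewrite cW; apply: (leq_trans leW1); rewrite leq_mul2l; apply/orP; right.
apply: (few_bounded_units av _ _ _ _ bW1).
- by move=> g; exact: galois_place_nat.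
- exact: galois_product_formula.
- by apply: contra W0; apply: (fsubsetP W1W).
- move=> x y /(fsubsetP W1W) Wx /(fsubsetP W1W) Wy; apply: (@integral_fmorph _ _ iota).
  by rewrite -fdiv; apply: intP1; rewrite P1E; apply/imfsetP; [exists x|exists y].
- move=> g dg; apply: adepW => i /dg[x [y [Wx Wy ->]]].
  by exists x, y; rewrite !(fsubsetP W1W).
(* Here 2R = 2^(2Q+1), just below 2^s. *)
have -> : 4 = 2 ^+ 2 :> algR by rewrite -natrX.
rewrite -exprM -exprS ltr_eXn2l; first by rewrite mul2n doubleS ltnS.
by rewrite ltr1n.
Qed.

(* Choice of parameters *)
Local Close Scope ring_scope.

Lemma loglog_large b0 : exists N0, forall N, N0 <= N -> b0 <= trunc_log 2 (trunc_log 2 N).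
Proof.
exists (2 ^ (2 ^ b0)) => N NN.
by apply: trunc_log_max => //; apply: trunc_log_max.
Qed.

(** For c = d and b <= 8d + 7 the left side bounds the exponent of 2 in the conclusion of
    [piece_bound]; the right side is at most a/2. *)
Lemma exponent_bound c : 2 <= c ->
  4 * c.+1 * (8 * c + 9) + 2 * c.+1 ^ 2 * 2 ^ c.+1 + 4 * c < 2 ^ (8 * c - 2).
Proof.
move=> c2; have h1 : c.+1 <= 2 ^ c by apply: ltn_expl.
have h2 : 8 * c + 9 <= 17 * 2 ^ c by lia.
have -> : 8 * c - 2 = 3 * c + (5 * c - 2) by lia.
rewrite expnD [3 * c]mulnC expnM.
have : 2 ^ 8 <= 2 ^ (5 * c - 2) by rewrite leq_exp2l //; lia.
rewrite [2 ^ c.+1]expnS; move: (2 ^ c) (2 ^ (5 * c - 2)) h1 h2 => x y h1 h2 hy.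
have e1 : c.+1 * (8 * c + 9) <= 17 * x ^ 2.
  by rewrite -mulnn mulnCA leq_mul.
have x1 : 0 < x by lia.
have e2 : c.+1 ^ 2 * x <= x ^ 3 by rewrite [leqRHS]expnSr leq_mul2r leq_exp2r // h1 orbT.
have e3 : x ^ 2 <= x ^ 3 by rewrite [leqRHS]expnSr leq_pmulr.
have e4 : x <= x ^ 2 by rewrite -mulnn leq_pmulr.
have e5 : x ^ 3 * 2 ^ 8 <= x ^ 3 * y by rewrite leq_mul2l hy orbT.
have z0 : 0 < x ^ 3 by rewrite expn_gt0 x1.
apply: leq_trans e5; rewrite -(mulnA 4 c.+1) (mulnACA 2 _ 2 x).
move: (c.+1 * _) (c.+1 ^ 2 * x) (x ^ 3) (x ^ 2) e1 e2 e3 e4 z0 => A B z w.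
by rewrite (_ : 2 ^ 8 = 256) //; lia.
Qed.

Lemma sumset_sub (K : fieldType) (A B : {fset K}) : A `<=` B -> sumset A `<=` sumset B.
Proof.
move=> AB; apply/fsubsetP=> _ /imfsetP[C /= + ->].
by rewrite fpowersetE => CA; apply: in_imfset; rewrite /= fpowersetE (fsubset_trans CA).
Qed.

Lemma prodset_sub (K : fieldType) (A B : {fset K}) : A `<=` B -> prodset A `<=` prodset B.
Proof.
move=> AB; apply/fsubsetP=> _ /imfsetP[C /= + ->].
by rewrite fpowersetE => CA; apply: in_imfset; rewrite /= fpowersetE (fsubset_trans CA).
Qed.

Lemma sum_product_bound (K : closedFieldType) (A : {fset K}) a b :
    has_pchar0 K -> 16 <= b -> 2 ^ b <= a < 2 ^ b.+1 -> 2 ^ a <= #|` A| ->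
  2 ^ ((b %/ 8).+1 * a %/ 8) < #|` sumset A| + #|` prodset A|.
Proof.
move=> hK b16 /andP[ba ab] aA; set d := b %/ 8; set t := _ %/ 8.
(* Quotients require removing 0; at least 2^(a-1) elements remain. *)
pose A' := A `\ 0%R; have A'A : A' `<=` A by apply: fsubsetDl.
have A'0 : 0%R \notin A' by rewrite !inE eqxx.
have cA' : 2 ^ a.-1 <= #|` A'|.
  have : #|` A| <= #|` A'|.+1 by rewrite (cardfsD1 0%R) -add1n leq_add2r leq_b1.
  have a0 : 0 < a by apply: leq_trans ba; rewrite expn_gt0.
  have : 0 < 2 ^ a.-1 by rewrite expn_gt0.
  by move: aA; rewrite -[X in 2 ^ X](prednK a0) expnS; lia.
rewrite ltnNge; apply/negP => small.
have leS : #|` sumset A'| <= 2 ^ t.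
  apply: leq_trans (fsubset_leq_card (sumset_sub A'A)) _.
  by apply: leq_trans small; rewrite leq_addr.
have leP : #|` prodset A'| <= 2 ^ t.
  apply: leq_trans (fsubset_leq_card (prodset_sub A'A)) _.
  by apply: leq_trans small; rewrite leq_addl.
have d2 : 2 <= d by rewrite /d leq_divRL.
have bd : 8 * d <= b <= 8 * d + 7 by rewrite /d; lia.
have ba' : 2 ^ (b - 8) * 256 <= a.
  by apply: leq_trans ba; rewrite -[X in _ <= 2 ^ X](@subnK 8) ?expnD //; lia.
(* Equivalent to 3b + 3 + a/3 + a/2 <= a - 1, which makes the blocks fit into [A']. *)
have lea : 18 * b + 24 <= a.
  have := ltn_expl (b - 8) (ltnSn 1); move: ba'; move: (2 ^ (b - 8)) => x; lia.
have ta : t <= d.+1 * a by rewrite /t leq_div.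
have t8 : t * 8 <= d.+1 * a by rewrite leq_trunc_div.
have t0 : 0 < t by rewrite /t divn_gt0 //; nia.
have db : d.+1 <= 2 ^ b.
  by apply: (@leq_trans b); [rewrite /d; lia|apply/ltnW/ltn_expl].
have tb : t <= 2 ^ (2 * b + 1).
  have -> : 2 * b + 1 = b + b.+1 by lia.
  by rewrite expnD; apply: leq_trans ta _; rewrite leq_mul // ltnW.
(* E^(d+1) is about 2^((d+1) a/3), which beats 2^(2t) because 2t <= (d+1) a/4. The block size
   2^(a/2) is what contradicts [piece_bound]. *)
pose E := 2 ^ (a %/ 3); pose Q := (d.+1 * 2 ^ d.+1).+1.
have := @piece_bound K A' t d (d.+1 * E) (2 ^ (a %/ 2)) E Q hK A'0 t0.
rewrite expn_gt0 leqnn ltnSn => /(_ isT) H.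
have {H} : 2 ^ (a %/ 2) <= t ^ d.+1 * (t ^ d.+1 * 2 ^ (d * Q.+1.*2)).
  apply: H => //.
    apply: leq_trans cA'.
    have : d.+1 * t.*2.+1 <= 2 ^ (3 * b + 3).
      have -> : 3 * b + 3 = b + (2 + (2 * b + 1)) by lia.
      rewrite expnD leq_mul // expnD; apply: leq_trans (leq_mul (leqnn (2 ^ 2)) tb).
      by move: t0; rewrite -muln2; lia.
    move=> h; rewrite (mulnAC d.+1) -[_ * 2 ^ (a %/ 2)]mulnA -expnD.
    apply: leq_trans (leq_mul h (leqnn _)) _; rewrite -expnD leq_exp2l //; lia.
  rewrite /E -expnM ltn_exp2l //.
  have : 3 * (d.+1 * (a %/ 3)) + 2 * d.+1 >= d.+1 * a.
    have : a <= 3 * (a %/ 3) + 2 by lia.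
    by move/(leq_mul (leqnn d.+1)); lia.
  have : d.+1 * 24 <= d.+1 * a by rewrite leq_mul2l; lia.
  by rewrite [_ * d.+1]mulnC; lia.
apply/negP; rewrite -ltnNge.
apply: (@leq_ltn_trans (2 ^ ((2 * b + 1) * d.+1 + ((2 * b + 1) * d.+1 + d * Q.+1.*2)))).
  by rewrite !expnD !(expnM 2 (2 * b + 1)) !leq_mul // leq_exp2r.
rewrite ltn_exp2l //; apply: (@leq_trans (2 ^ (8 * d - 2))); last first.
  apply: (@leq_trans (2 ^ (b - 1))); first by rewrite leq_exp2l //; lia.
  rewrite leq_divRL // -expnSr; apply: leq_trans ba; rewrite leq_exp2l //; lia.
apply: leq_trans (exponent_bound d2); rewrite ltnS /Q.
have : 2 * d * (d.+1 * 2 ^ d.+1) <= 2 * d.+1 * (d.+1 * 2 ^ d.+1) by rewrite leq_mul2r; lia.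
have : (2 * b + 1) * d.+1 <= (16 * d + 15) * d.+1 by rewrite leq_mul2r; lia.
rewrite -mulnn; move: (2 ^ d.+1) => y; nia.
Qed.

(** Since b <= 8(d+1), 64 t is at least a b up to rounding; 264 leaves room for replacing a and b by
    a + 1 and b + 1, the upper bounds for the two iterated logarithms. *)
Lemma block_count_bound a b : (16 <= b)%N -> (2 ^ b <= a)%N ->
  (a.+1 * b.+1 <= 264 * ((b %/ 8).+1 * a %/ 8))%N.
Proof.
move=> b16 ba.
have ba' : (2 ^ (b - 8) * 256 <= a)%N.
  by apply: leq_trans ba; rewrite -[X in (_ <= 2 ^ X)%N](@subnK 8) ?expnD //; lia.
have lea : (18 * b + 24 <= a)%N.
  have := ltn_expl (b - 8) (ltnSn 1); move: ba'; move: (2 ^ (b - 8))%N => x; lia.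
have h1 : (b * a <= 8 * ((b %/ 8).+1 * a))%N.
  by rewrite mulnA leq_mul2r; apply/orP; right; lia.
have h2 : ((b %/ 8).+1 * a < 8 * ((b %/ 8).+1 * a %/ 8) + 8)%N by lia.
have h3 : (16 * a <= b * a)%N by rewrite leq_mul2r b16 orbT.
have -> : (a.+1 * b.+1 = b * a + a + b + 1)%N by lia.
move: h1 h2 h3.
by move: (b * a)%N ((b %/ 8).+1 * a)%N ((b %/ 8).+1 * a %/ 8)%N => z x y; lia.
Qed.

(* Passage to real logarithms *)
From Stdlib Require Import Reals Lra.

Lemma INR_expn2 n : INR (expn 2 n) = (2 ^ n)%R.
Proof. by elim: n => [|n IH] //; rewrite expnS -multE mult_INR IH. Qed.

Lemma ln_le x y : (0 < x)%R -> (x <= y)%R -> (ln x <= ln y)%R.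
Proof. by move=> x0 [xy|->]; [left; apply: ln_increasing|right]. Qed.

Lemma ln2_bounds : (1 / 2 < ln 2 <= 1)%R.
Proof.
split; first by have := ln_lt_2; Lra.lra.
have h : (2 <= exp 1)%R by have := exp_ineq1_le 1; Lra.lra.
by rewrite -(ln_exp 1); apply: ln_le; Lra.lra.
Qed.

Lemma ln_pow2 n : ln (2 ^ n) = (INR n * ln 2)%R.
Proof. by rewrite ln_pow //; Lra.lra. Qed.

Lemma ln_bounds (n a : nat) : (expn 2 a <= n)%N -> (n < expn 2 a.+1)%N ->
  (INR a * ln 2 <= ln (INR n) <= INR a.+1 * ln 2)%R.
Proof.
move=> /ssrnat.leP/le_INR an /ssrnat.ltP/lt_INR na.
rewrite !INR_expn2 in an na.
have p : (0 < 2 ^ a)%R by apply: pow_lt; Lra.lra.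
by rewrite -!ln_pow2; split; apply: ln_le; Lra.lra.
Qed.

Theorem theorem1 (K : closedFieldType) (hK : has_pchar0 K) :
  forall eps : R, (0 < eps)%R ->
  exists N0 : nat, forall N : nat, (N0 <= N)%N ->
  forall A : {fset K}, #|` A| = N ->
    (Rpower (INR N) ((1 / 264 - eps) * (ln (ln (INR N)) / ln (ln (ln (INR N)))))
      <= INR (#|` sumset A| + #|` prodset A|))%R.
Proof.
(* b >= 16 gives d >= 2, as [exponent_bound] asks. *)
move=> eps eps0; have [N0 N0P] := loglog_large 16; exists N0 => N /N0P.
set a := trunc_log 2 N; set b := trunc_log 2 a => b16 A cA.
have a0 : (0 < a)%N by rewrite lt0n; apply: contraTneq b16; rewrite /b => ->.
have N0' : (0 < N)%N by rewrite lt0n; apply: contraTneq a0; rewrite /a => ->.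
have bab : (expn 2 b <= a < expn 2 b.+1)%N by rewrite trunc_logP // trunc_log_ltn.
have aNa : (expn 2 a <= N < expn 2 a.+1)%N by rewrite trunc_logP // trunc_log_ltn.
have main : (expn 2 ((b %/ 8).+1 * a %/ 8) <= #|` sumset A| + #|` prodset A|)%N.
  by apply/ltnW/(sum_product_bound hK b16 bab); rewrite cA; case/andP: aNa.
have [ba ab] := andP bab; have [aN Na] := andP aNa.
move: main (block_count_bound b16 ba); move: (_ %/ 8)%N => t main count.
have [lo2 hi2] := ln2_bounds.
have [lN1 lN2] := ln_bounds aN Na; have [la1 la2] := ln_bounds ba ab.
set L1 := ln (INR N) in lN1 lN2 *.
have ra : (1 < INR a)%R.
  have /ssrnat.ltP/lt_INR : (1 < a)%N by apply: leq_trans ba; apply: (@leq_trans (expn 2 16)) => //; rewrite leq_exp2l.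
  by [].
have rb : (16 <= INR b)%R.
  by move/ssrnat.leP/le_INR: b16; rewrite (_ : INR 16 = 16%R) //; rewrite INR_IZR_INZ.
have L1lo : (INR a / 2 <= L1)%R.
  by apply: Rle_trans lN1; have := Rmult_le_compat_l (INR a) (1/2) (ln 2); Lra.lra.
have L1pos : (0 < L1)%R by Lra.lra.
(* Since ln 2 > 1/2, passing from binary to natural logarithms at most halves a, which lowers b by
   1. *)
have L2lo : ((INR b - 1) * ln 2 <= ln L1)%R.
  have -> : ((INR b - 1) * ln 2 = INR b * ln 2 - ln 2)%R by Lra.lra.
  have : (ln (INR a / 2) + ln 2 = ln (INR a))%R.
    by rewrite -ln_mult; try Lra.lra; congr ln; Lra.lra.
  have := @ln_le (INR a / 2) L1; Lra.lra.
have L2hi : (ln L1 <= INR b.+1)%R.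
  have h : (L1 <= 2 ^ b.+1)%R.
    apply: (Rle_trans _ (INR a.+1)).
      have := Rmult_le_compat_l (INR a.+1) (ln 2) 1 (pos_INR _); Lra.lra.
    by rewrite -INR_expn2; apply/le_INR/ssrnat.leP.
  apply: (Rle_trans _ _ _ (ln_le L1pos h)).
  by rewrite ln_pow2; have := Rmult_le_compat_l (INR b.+1) (ln 2) 1 (pos_INR _); Lra.lra.
set L2 := ln L1 in L2lo L2hi *.
(* 3 exceeds e, so the third logarithm is at least 1 and dividing by it does not increase the
   exponent. *)
have L2big : (3 <= L2)%R.
  have := Rmult_le_compat (INR b - 1) (INR b - 1) (1/2) (ln 2); Lra.lra.
have L3 : (1 <= ln L2)%R.
  by rewrite -(ln_exp 1); apply: ln_le; [exact: exp_pos|have := exp_le_3; Lra.lra].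
have q1 : (0 <= L2 / ln L2 <= L2)%R.
  split; first by apply: Rmult_le_pos; [Lra.lra|left; apply: Rinv_0_lt_compat; Lra.lra].
  apply: (Rmult_le_reg_r (ln L2)); first Lra.lra.
  rewrite /Rdiv Rmult_assoc Rinv_l; last Lra.lra.
  by have := Rmult_le_compat_l L2 1 (ln L2); Lra.lra.
apply: (Rle_trans _ (2 ^ t)%R); last first.
  by rewrite -INR_expn2; apply/le_INR/ssrnat.leP.
rewrite -(exp_ln (2 ^ t)%R); last by apply: pow_lt; Lra.lra.
rewrite /Rpower -/L1 ln_pow2.
have count' : (INR a.+1 * INR b.+1 <= 264 * INR t)%R.
  move/ssrnat.leP/le_INR: count; rewrite -!multE !mult_INR.
  by rewrite (_ : INR 264 = 264%R) // INR_IZR_INZ.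
have e1 : ((1 / 264 - eps) * (L2 / ln L2) <= INR b.+1 / 264)%R.
  have := Rmult_le_compat_r (L2 / ln L2) (1 / 264 - eps) (1 / 264); Lra.lra.
have e2 : ((1 / 264 - eps) * (L2 / ln L2) * L1 <= INR b.+1 / 264 * (INR a.+1 * ln 2))%R.
  apply: (Rle_trans _ (INR b.+1 / 264 * L1)); first by apply: Rmult_le_compat_r; Lra.lra.
  by apply: Rmult_le_compat_l => //; have := pos_INR b.+1; Lra.lra.
have e3 : (INR a.+1 * INR b.+1 * ln 2 <= 264 * INR t * ln 2)%R.
  by apply: Rmult_le_compat_r; Lra.lra.
have [h|->] : ((1 / 264 - eps) * (L2 / ln L2) * L1 <= INR t * ln 2)%R by Lra.lra.
  by left; apply: exp_increasing.
by right.
Qed.
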